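(* The category $\Delta\circlearrowright\Delta$, equipped with the wide subcategories $(\Delta\circlearrowright\Delta)^+$ and $(\Delta\circlearrowright\Delta)^-$ and the degree function $d[n\circlearrowright k]=n+|\mathrm{Ob}(\mathcal D_{n,k})|$, is a (strict) Reedy category.
   Context: **Actions.** For a small category $\mathcal C$, let $C_0,C_1$ be its sets of objects and morphisms, with source and target maps $s,t$. An action of $\mathcal C$ on a set $A$ consists of a moment map $\mu:A\to C_0$ and an action map $\bullet:\{(f,a)\in C_1\times A: s(f)=\mu(a)\}\to A$ such that $\mu(f\bullet a)=t(f)$, $(f\circ f')\bullet a=f\bullet(f'\bullet a)$ whenever defined, and $\mathrm{id}_{\mu(a)}\bullet a=a$. A *rooted action* of $\mathcal C$ on a small category $\mathcal D$, written $\mathcal C\circlearrowright\mathcal D$, is an action of $\mathcal C$ on the set $D_1$ of morphisms of $\mathcal D$ such that $\mu(g\circ g')=\mu(g)$ for all composable $g,g'\in D_1$, and $s(f\bullet g)=s(g)$ whenever $f\bullet g$ is defined. For an object $x$ of $\mathcal D$ put $\mu(x):=\mu(\mathrm{id}_x)$; then $\mu(g)=\mu(t(g))$. $\mathcal{RA}$ is the category of rooted actions; a morphism $X:(\mathcal C\circlearrowright\mathcal D)\to(\mathcal C'\circlearrowright\mathcal D')$ is a pair of functors $X^c:\mathcal C\to\mathcal C'$, $X^d:\mathcal D\to\mathcal D'$ with $\mu(X^d(g))=X^c(\mu(g))$ and $X^d(f\bullet g)=X^c(f)\bullet X^d(g)$. **The objects $[n\circlearrowright k]$** ($n\ge0$,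 $k\ge-1$). Let $[n]$ be the ordered set $0\le1\le\dots\le n$ viewed as a category, $[-1]=\varnothing$. $\mathcal C_{n,k}$ is the disjoint union of $[n]$ and a discrete category with objects $*_0,\dots,*_{k-1}$; write $p_{i,j}:i\to j$ for the unique map in $[n]$. $\mathcal D_{n,-1}$ is empty. For $k\ge0$, $\mathcal D_{n,k}$ is a free category built inductively: $\mathcal D_{0,k}=[k]$ with $\mu(i)=*_i$ for $0\le i<k$ and $\mu(k)=0$; and $\mathcal D_{n,k}$ is obtained from $\mathcal D_{n-1,k}$ by freely adjoining, for each morphism $h$ of $\mathcal D_{n-1,k}$ (identities and composites included) with $\mu(h)=n-1$, a new object $(n,h)$ (distinct for distinct $h$) and a new generating arrow $p_{n-1,n}\bullet h:s(h)\to(n,h)$, with $\mu((n,h))=n$. The action of $\mathcal C_{n,k}$ on $\mathcal D_{n,k}$ is $p_{\ell,\ell'}\bullet h=p_{\ell'-1,\ell'}\bullet(\cdots\bullet(p_{\ell,\ell+1}\bullet h))$, identities acting trivially. This rooted action is $[n\circlearrowright k]$. $\Delta\circlearrowright\Delta$ is the full subcategory of $\mathcal{RA}$ on the objects $[n\circlearrowright k]$, $n\ge0,k\ge-1$. **Notation for maps.** A map $X:[n\circlearrowright k]\to[m\circlearrowright\ell]$ is determined by its restrictions $\alpha=X^c|_{[n]}:[n]\to\mathcal C_{m,\ell}$ and $\beta=X^d|_{\mathcal D_{0,k}}:[k]\to\mathcal D_{m,\ell}$; write $X=(\alpha,\beta)$, $\hat\alpha=X^c$, $\hat\beta=X^d$.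 **Subcategories.** $(\Delta\circlearrowright\Delta)^+$: maps $(\alpha,\beta)$ with $\alpha:[n]\to\mathcal C_{m,\ell}$ and $\beta:[k]\to\mathcal D_{m,\ell}$ injective on objects. $(\Delta\circlearrowright\Delta)^-$: maps $(\alpha,\beta)$ such that every object of $[m]\subseteq\mathcal C_{m,\ell}$ is in the image of $\alpha$ and $\hat\beta:\mathcal D_{n,k}\to\mathcal D_{m,\ell}$ is surjective on objects. **Reedy category.** A small category $\mathcal R$ with wide subcategories (i.e. containing all objects) $\mathcal R^+,\mathcal R^-$ and a function $d:\mathrm{Ob}\,\mathcal R\to\mathbb N$ such that every non-identity morphism of $\mathcal R^+$ raises degree, every non-identity morphism of $\mathcal R^-$ lowers degree, and every morphism of $\mathcal R$ factors uniquely as a morphism of $\mathcal R^-$ followed by a morphism of $\mathcal R^+$. *)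

(* Defs.v *)
From HB Require Import structures.
From mathcomp Require Import all_boot.
From mathcomp Require Import boolp.

Set Implicit Arguments.
Unset Strict Implicit.
Unset Printing Implicit Defensive.

(* Small categories are given by a set of objects, a set of morphisms and
   source and target maps; [comp C g f e] is g o f, defined only in the
   presence of a proof [e] that the pair is composable.  Such proofs are
   irrelevant, so the laws quantify over all of them. *)

Record catStr (O M : Type) := CatStr {
  src : M -> O;
  tgt : M -> O;
  idm : O -> M;
  comp : forall g f : M, src g = tgt f -> M;
  src_idm : forall x, src (idm x) = x;
  tgt_idm : forall x, tgt (idm x) = x;
  src_comp : forall g f (e : src g = tgt f), src (comp e) = src f;
  tgt_comp : forall g f (e : src g = tgt f), tgt (comp e) = tgt g;
  comp_idl : forall f (e : src (idm (tgt f)) = tgt f), comp e = f;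
  comp_idr : forall f (e : src f = tgt (idm (src f))), comp e = f;
  comp_assoc : forall h g f (e1 : src g = tgt f) (e2 : src h = tgt (comp e1))
    (e3 : src h = tgt g) (e4 : src (comp e3) = tgt f), comp e2 = comp e4
}.
Arguments src {O M} c _.
Arguments tgt {O M} c _.
Arguments idm {O M} c _.
Arguments comp {O M} c g f _.

Lemma comp_irr O M (C : catStr O M) g f (e e' : src C g = tgt C f) :
  comp C g f e = comp C g f e'.
Proof. by congr comp; apply: Prop_irrelevance. Qed.

Lemma comp_congr O M (C : catStr O M) g f g' f'
    (e : src C g = tgt C f) (e' : src C g' = tgt C f') :
  g = g' -> f = f' -> comp C g f e = comp C g' f' e'.
Proof. by move=> eg ef; subst g' f'; apply: comp_irr. Qed.

Lemma comp_idlE O M (C : catStr O M) x f (e : src C (idm C x) = tgt C f) :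
  comp C (idm C x) f e = f.
Proof.
have ex : x = tgt C f by rewrite -e src_idm.
by subst x; apply: comp_idl.
Qed.

Lemma comp_idrE O M (C : catStr O M) x f (e : src C f = tgt C (idm C x)) :
  comp C f (idm C x) e = f.
Proof.
have ex : x = src C f by rewrite e tgt_idm.
by subst x; apply: comp_idr.
Qed.

Record category := Category {
  Ob : Type;
  Mor : Type;
  str :> catStr Ob Mor
}.

Record functor (C D : category) := Functor {
  fob : Ob C -> Ob D;
  fmor :> Mor C -> Mor D;
  f_src : forall f, src D (fmor f) = fob (src C f);
  f_tgt : forall f, tgt D (fmor f) = fob (tgt C f);
  f_idm : forall x, fmor (idm C x) = idm D (fob x);
  f_comp : forall g f (e : src C g = tgt C f)
    (e' : src D (fmor g) = tgt D (fmor f)),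
    fmor (comp C g f e) = comp D (fmor g) (fmor f) e'
}.

Arguments f_comp {C D} f0 {g f} e e'.

Lemma functor_eq (C D : category) (F G : functor C D) :
  fob F = fob G -> fmor F = fmor G -> F = G.
Proof.
case: F G => [fo fm a b c d] [go gm a' b' c' d'] /= E1 E2; subst go gm.
by congr Functor; apply: Prop_irrelevance.
Qed.

Definition idF (C : category) : functor C C :=
  @Functor C C id id (fun=> erefl) (fun=> erefl) (fun=> erefl) (@comp_irr _ _ C).

Section FunctorComp.
Variables (C D E : category) (G : functor D E) (F : functor C D).

Lemma compF_src f : src E (G (F f)) = fob G (fob F (src C f)).
Proof. by rewrite f_src f_src. Qed.

Lemma compF_tgt f : tgt E (G (F f)) = fob G (fob F (tgt C f)).
Proof. by rewrite f_tgt f_tgt. Qed.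

Lemma compF_idm x : G (F (idm C x)) = idm E (fob G (fob F x)).
Proof. by rewrite f_idm f_idm. Qed.

Lemma compF_comp g f (e : src C g = tgt C f)
    (e' : src E (G (F g)) = tgt E (G (F f))) :
  G (F (comp C g f e)) = comp E (G (F g)) (G (F f)) e'.
Proof.
have e1 : src D (F g) = tgt D (F f) by rewrite f_src f_tgt e.
by rewrite (f_comp F e e1) (f_comp G e1 e').
Qed.

Definition compF : functor C E :=
  @Functor C E (fun x => fob G (fob F x)) (fun f => G (F f))
    compF_src compF_tgt compF_idm compF_comp.
End FunctorComp.

Record action (C : category) (A : Type) := Action {
  mu : A -> Ob C;
  act : forall (f : Mor C) (a : A), src C f = mu a -> A;
  mu_act : forall f a (e : src C f = mu a), mu (act e) = tgt C f;
  act_comp : forall f f' a (e : src C f = tgt C f')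
    (e1 : src C (comp C f f' e) = mu a) (e2 : src C f' = mu a)
    (e3 : src C f = mu (act e2)), act e1 = act e3;
  act_id : forall a (e : src C (idm C (mu a)) = mu a), act e = a
}.
Arguments mu {C A} _ _.
Arguments act {C A} _ f a _.

Record rooted_action := RootedAction {
  raC : category;
  raD : category;
  raA :> action raC (Mor raD);
  mu_rooted : forall g g' (e : src raD g = tgt raD g'),
    mu raA (comp raD g g' e) = mu raA g;
  src_rooted : forall f g (e : src raC f = mu raA g),
    src raD (act raA f g e) = src raD g
}.

Record ra_mor (X Y : rooted_action) := RAMor {
  Fc : functor (raC X) (raC Y);
  Fd : functor (raD X) (raD Y);
  ra_mu : forall g, mu Y (Fd g) = fob Fc (mu X g);
  ra_act : forall f g (e : src (raC X) f = mu X g)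
    (e' : src (raC Y) (Fc f) = mu Y (Fd g)),
    Fd (act X f g e) = act Y (Fc f) (Fd g) e'
}.

Arguments ra_act {X Y} r {f g} e e'.

Lemma ra_mor_eq X Y (F G : ra_mor X Y) : Fc F = Fc G -> Fd F = Fd G -> F = G.
Proof.
case: F G => [fc fd a b] [gc gd a' b'] /= E1 E2; subst gc gd.
by congr RAMor; apply: Prop_irrelevance.
Qed.

Lemma ra_id_act (X : rooted_action) f g (e e' : src (raC X) f = mu X g) :
  act X f g e = act X f g e'.
Proof. by congr act; apply: Prop_irrelevance. Qed.

Definition ra_id (X : rooted_action) : ra_mor X X :=
  @RAMor X X (idF _) (idF _) (fun=> erefl) (@ra_id_act X).

Section RAComp.
Variables (X Y Z : rooted_action) (G : ra_mor Y Z) (F : ra_mor X Y).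

Lemma ra_comp_mu g : mu Z (Fd G (Fd F g)) = fob (Fc G) (fob (Fc F) (mu X g)).
Proof. by rewrite ra_mu ra_mu. Qed.

Lemma ra_comp_act f g (e : src (raC X) f = mu X g)
    (e' : src (raC Z) (Fc G (Fc F f)) = mu Z (Fd G (Fd F g))) :
  Fd G (Fd F (act X f g e)) = act Z (Fc G (Fc F f)) (Fd G (Fd F g)) e'.
Proof.
have e1 : src (raC Y) (Fc F f) = mu Y (Fd F g) by rewrite f_src ra_mu e.
by rewrite (ra_act F e e1) (ra_act G e1 e').
Qed.

Definition ra_comp : ra_mor X Z :=
  @RAMor X Z (compF (Fc G) (Fc F)) (compF (Fd G) (Fd F)) ra_comp_mu ra_comp_act.
End RAComp.

(* The full subcategory of RA on a family X of rooted actions. *)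
Section FullRA.
Variables (I : Type) (X : I -> rooted_action).

Record full_mor := FullMor {
  fm_dom : I;
  fm_cod : I;
  fm_map :> ra_mor (X fm_dom) (X fm_cod)
}.

Definition full_id (i : I) : full_mor := FullMor (ra_id (X i)).

Definition full_comp (g f : full_mor) (e : fm_dom g = fm_cod f) : full_mor :=
  FullMor (ra_comp (ecast i (ra_mor (X i) (X (fm_cod g))) e (fm_map g))
                   (fm_map f)).

Lemma full_comp_idl f (e : fm_dom (full_id (fm_cod f)) = fm_cod f) :
  full_comp e = f.
Proof.
case: f e => i j f /= e; rewrite (Prop_irrelevance e erefl) /full_comp /=.
by congr FullMor; apply: ra_mor_eq; apply: functor_eq.
Qed.

Lemma full_comp_idr f (e : fm_dom f = fm_cod (full_id (fm_dom f))) :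
  full_comp e = f.
Proof.
case: f e => i j f /= e; rewrite (Prop_irrelevance e erefl) /full_comp /=.
by congr FullMor; apply: ra_mor_eq; apply: functor_eq.
Qed.

Lemma full_comp_assoc h g f (e1 : fm_dom g = fm_cod f)
    (e2 : fm_dom h = fm_cod (full_comp e1)) (e3 : fm_dom h = fm_cod g)
    (e4 : fm_dom (full_comp e3) = fm_cod f) : full_comp e2 = full_comp e4.
Proof.
case: h g f e1 e2 e3 e4 => [k l h] [j k' g] [i j' f] /= e1 e2 e3 e4.
subst j' k'; rewrite (Prop_irrelevance e3 erefl) (Prop_irrelevance e4 erefl).
by rewrite /full_comp /=; congr FullMor; apply: ra_mor_eq; apply: functor_eq.
Qed.

Definition full_RA : category :=
  @Category I full_mor
    (@CatStr I full_mor fm_dom fm_cod full_id full_comp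
       (fun=> erefl) (fun=> erefl) (fun _ _ _ => erefl) (fun _ _ _ => erefl)
       full_comp_idl full_comp_idr full_comp_assoc).
End FullRA.

(* The poset 0 <= ... <= N-1 as a category, so that [n] is [ordCat n.+1];
   its morphisms are the pairs (i, j) with i <= j. *)
Section OrdCat.
Variable N : nat.

Definition ordMor : finType := {p : 'I_N * 'I_N | p.1 <= p.2}.

Definition ord_arr (i j : 'I_N) (le_ij : i <= j) : ordMor :=
  exist (fun p : 'I_N * 'I_N => p.1 <= p.2) (i, j) le_ij.

Lemma ord_comp_proof (g f : ordMor) :
  (val g).1 = (val f).2 -> (val f).1 <= (val g).2.
Proof. by move=> e; apply: leq_trans (valP f) _; rewrite -e (valP g). Qed.

Lemma ordMor_eq (g f : ordMor) :
  (val g).1 = (val f).1 -> (val g).2 = (val f).2 -> g = f.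
Proof.
move=> e1 e2; apply: val_inj; rewrite [val g]surjective_pairing e1 e2.
by rewrite -surjective_pairing.
Qed.

Definition ordStr : catStr 'I_N ordMor.
Proof.
refine (@CatStr 'I_N ordMor (fun f => (val f).1) (fun f => (val f).2)
  (fun i => ord_arr (leqnn i)) (fun g f e => ord_arr (ord_comp_proof e))
  _ _ _ _ _ _ _) => // *; exact: ordMor_eq.
Defined.

Definition ordCat : category := Category ordStr.
End OrdCat.

Definition discCat (T : Type) : category :=
  @Category T T (@CatStr T T id id id (fun _ f _ => f)
    (fun=> erefl) (fun=> erefl) (fun _ _ _ => erefl) (fun _ _ e => esym e)
    (fun _ _ => erefl) (fun _ _ => erefl) (fun _ _ _ _ _ _ _ => erefl)).

Section SumCat.
Variables C D : category.

Definition sum_src (f : Mor C + Mor D) : Ob C + Ob D :=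
  match f with inl f => inl (src C f) | inr f => inr (src D f) end.

Definition sum_tgt (f : Mor C + Mor D) : Ob C + Ob D :=
  match f with inl f => inl (tgt C f) | inr f => inr (tgt D f) end.

Definition sum_idm (x : Ob C + Ob D) : Mor C + Mor D :=
  match x with inl x => inl (idm C x) | inr x => inr (idm D x) end.

Lemma inl_inj_eq (A B : Type) (x y : A) : inl B x = inl y -> x = y.
Proof. by case. Qed.

Lemma inr_inj_eq (A B : Type) (x y : B) : inr A x = inr y -> x = y.
Proof. by case. Qed.

Lemma inl_neq_inr (A B : Type) (x : A) (y : B) : inl x = inr y -> False.
Proof. by []. Qed.

Lemma inr_neq_inl (A B : Type) (x : A) (y : B) : inr y = inl x -> False.
Proof. by []. Qed.

Definition sum_comp (g f : Mor C + Mor D) :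
    sum_src g = sum_tgt f -> Mor C + Mor D :=
  match g, f return sum_src g = sum_tgt f -> _ with
  | inl g, inl f => fun e => inl (comp C g f (inl_inj_eq e))
  | inr g, inr f => fun e => inr (comp D g f (inr_inj_eq e))
  | inl _, inr _ => fun e => False_rect _ (inl_neq_inr e)
  | inr _, inl _ => fun e => False_rect _ (inr_neq_inl e)
  end.

Definition sumStr : catStr (Ob C + Ob D)%type (Mor C + Mor D)%type.
Proof.
refine (@CatStr _ _ sum_src sum_tgt sum_idm sum_comp _ _ _ _ _ _ _).
- by case=> x /=; rewrite src_idm.
- by case=> x /=; rewrite tgt_idm.
- by case=> [g|g] [f|f] //= e; rewrite src_comp.
- by case=> [g|g] [f|f] //= e; rewrite tgt_comp.
- by case=> f e /=; rewrite comp_idl.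
- by case=> f e /=; rewrite comp_idr.
- move=> [h|h] [g|g] [f|f] e1 e2 e3 e4 //=; congr (_ _); exact: comp_assoc.
Defined.

Definition sumCat : category := Category sumStr.
End SumCat.

(* The category freely obtained from D by adjoining, for each i : I, a new
   object i and a new arrow s(i) -> i.  As no generator leaves a new object,
   every morphism is uniquely of one of the following forms:
   - inl g             : a morphism g of D;
   - inr (inl i)       : the identity of the new object i;
   - inr (inr (i, g))  : the new arrow s(i) -> i composed with a morphism
                         g : x -> s(i) of D.
   [adjoin_universal] below shows that this is the free construction. *)
Section Adjoin.
Variables (O M I : finType) (D : catStr O M) (s : I -> O).

Definition adjOb : finType := (O + I)%type.

Definition adjNew : finType := {p : I * M | tgt D p.2 == s p.1}.

Definition adjMor : finType := (M + (I + adjNew))%type.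

Definition adj_new (i : I) (g : M) (e : tgt D g = s i) : adjMor :=
  inr (inr (exist (fun p : I * M => tgt D p.2 == s p.1) (i, g)
                  (introT eqP e))).

Definition adj_gen (i : I) : adjMor := adj_new (tgt_idm D (s i)).

Definition adj_src (f : adjMor) : adjOb :=
  match f with
  | inl g => inl (src D g)
  | inr (inl i) => inr i
  | inr (inr p) => inl (src D (val p).2)
  end.

Definition adj_tgt (f : adjMor) : adjOb :=
  match f with
  | inl g => inl (tgt D g)
  | inr (inl i) => inr i
  | inr (inr p) => inr (val p).1
  end.

Definition adj_idm (x : adjOb) : adjMor :=
  match x with inl x => inl (idm D x) | inr i => inr (inl i) end.

Lemma adj_comp_proof (p : adjNew) (f : M) (e : src D (val p).2 = tgt D f) :
  tgt D (comp D (val p).2 f e) = s (val p).1.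
Proof. by rewrite tgt_comp; apply/eqP/(valP p). Qed.

Definition adj_comp (g f : adjMor) : adj_src g = adj_tgt f -> adjMor :=
  match g, f return adj_src g = adj_tgt f -> adjMor with
  | inl g, inl f => fun e => inl (comp D g f (inl_inj_eq e))
  | inr (inr p), inl f => fun e => adj_new (adj_comp_proof (inl_inj_eq e))
  | inr (inl _), inr f => fun _ => inr f
  | inl _, inr (inl _) => fun e => False_rect _ (inl_neq_inr e)
  | inl _, inr (inr _) => fun e => False_rect _ (inl_neq_inr e)
  | inr (inl _), inl _ => fun e => False_rect _ (inr_neq_inl e)
  | inr (inr _), inr (inl _) => fun e => False_rect _ (inl_neq_inr e)
  | inr (inr _), inr (inr _) => fun e => False_rect _ (inl_neq_inr e)
  end.

Lemma adj_new_eq (i j : I) (g h : M) (e : tgt D g = s i) (e' : tgt D h = s j) :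
  i = j -> g = h -> adj_new e = adj_new e'.
Proof. by move=> ei eg; congr (inr (inr _)); apply: val_inj; rewrite /= ei eg. Qed.

Lemma adj_newE (p : adjNew) (e : tgt D (val p).2 = s (val p).1) :
  adj_new e = inr (inr p).
Proof. by congr (inr (inr _)); apply: val_inj; rewrite /= -surjective_pairing. Qed.

Definition adjoin : catStr adjOb adjMor.
Proof.
refine (@CatStr _ _ adj_src adj_tgt adj_idm adj_comp _ _ _ _ _ _ _).
- by case=> x //=; rewrite src_idm.
- by case=> x //=; rewrite tgt_idm.
- move=> [g|[i|p]] [f|[j|q]] e //=; by rewrite src_comp.
- move=> [g|[i|p]] [f|[j|q]] e //=; by rewrite tgt_comp.
- move=> [f|[i|p]] e //=; by rewrite comp_idl.
- move=> [f|[i|p]] e //=; first by rewrite comp_idr.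
  rewrite -(adj_newE (elimT eqP (valP p))); apply: adj_new_eq => //.
  exact: comp_idr.
- move=> [h|[k|r]] [g|[i|p]] [f|[j|q]] e1 e2 e3 e4 //=.
  + by congr inl; apply: comp_assoc.
  + by apply: adj_new_eq => //; apply: comp_irr.
  + by apply: adj_new_eq => //; apply: comp_assoc.
Defined.

Definition adj_incl : functor (Category D) (Category adjoin).
Proof.
refine (@Functor (Category D) (Category adjoin) inl inl _ _ _ _) => //=.
by move=> g f e e'; congr inl; apply: comp_irr.
Defined.

Lemma adj_mor_eq (f : adjMor) : [\/ exists g, f = inl g,
  exists i, f = adj_idm (inr i) |
  exists i g (e : tgt D g = s i) (e' : adj_src (adj_gen i) = adj_tgt (inl g)),
    f = adj_comp e'].
Proof.
case: f => [g|[i|p]]; first by constructor 1; exists g.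
  by constructor 2; exists i.
have e := elimT eqP (valP p).
have e' : adj_src (adj_gen (val p).1) = adj_tgt (inl (val p).2).
  by rewrite /= src_idm e.
constructor 3; exists (val p).1, (val p).2, e, e'.
rewrite -(adj_newE e); apply: adj_new_eq => //=.
by rewrite comp_idlE.
Qed.

Section Universal.
Variables (E : category) (F : functor (Category D) E) (a : I -> Mor E).
Hypothesis src_a : forall i, src E (a i) = fob F (s i).

Lemma adj_ext_proof (p : adjNew) : src E (a (val p).1) = tgt E (F (val p).2).
Proof. by rewrite src_a f_tgt -(elimT eqP (valP p)). Qed.

Definition adj_ext_ob (x : adjOb) : Ob E :=
  match x with inl x => fob F x | inr i => tgt E (a i) end.

Definition adj_ext_mor (f : adjMor) : Mor E :=
  match f with
  | inl g => F g
  | inr (inl i) => idm E (tgt E (a i))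
  | inr (inr p) => comp E (a (val p).1) (F (val p).2) (adj_ext_proof p)
  end.

Definition adj_ext : functor (Category adjoin) E.
Proof.
refine (@Functor (Category adjoin) E adj_ext_ob adj_ext_mor _ _ _ _).
- by case=> [g|[i|p]] /=; rewrite ?f_src ?src_idm ?src_comp ?f_src.
- by case=> [g|[i|p]] /=; rewrite ?f_tgt ?tgt_idm ?tgt_comp.
- by case=> x //=; rewrite f_idm.
- move=> [g|[i|p]] [f|[j|q]] e e' //=.
  + exact: f_comp.
  + have Eij : i = j by move: e => /= [].
    by subst j; rewrite comp_idlE.
  + by rewrite comp_idlE.
  + have e1 : src E (F (val p).2) = tgt E (F f).
      by rewrite f_src f_tgt (inl_inj_eq e).
    have e2 : src E (a (val p).1) = tgt E (comp E (F (val p).2) (F f) e1).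
      by rewrite tgt_comp (adj_ext_proof p).
    rewrite -(@comp_assoc _ _ E (a (val p).1) (F (val p).2) (F f) e1 e2).
    by apply: comp_congr => //; apply: (f_comp F (inl_inj_eq e) e1).
Defined.

Lemma adj_ext_gen i : adj_ext (adj_gen i) = a i.
Proof.
rewrite /= -[RHS](@comp_idr _ _ E _ (esym (tgt_idm E _))).
by apply: comp_congr => //=; rewrite f_idm src_a.
Qed.

Lemma adjoin_universal : exists! F' : functor (Category adjoin) E,
  compF F' adj_incl = F /\ forall i, F' (adj_gen i) = a i.
Proof.
exists adj_ext; split.
  by split; [apply: functor_eq | apply: adj_ext_gen].
move=> F' [F'incl F'gen].
have Eob x : fob F' (inl x) = fob F x by rewrite -F'incl.
have Emor g : F' (inl g) = F g by rewrite -F'incl.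
have Enew i : fob F' (inr i) = tgt E (a i).
  by rewrite -F'gen (f_tgt F').
apply: functor_eq; apply: funext => /=.
  by case=> [x|i] /=; rewrite ?Eob ?Enew.
move=> f; have [[g ->]|[i ->]|[i [g [e [e' ->]]]]] := adj_mor_eq f.
- by rewrite Emor.
- by have -> := f_idm F' (inr i); rewrite Enew.
- have e1 : src E (adj_ext (adj_gen i)) = tgt E (adj_ext (inl g)).
    rewrite (f_src adj_ext) (f_tgt adj_ext); congr (fob adj_ext _); exact: e'.
  have e2 : src E (F' (adj_gen i)) = tgt E (F' (inl g)).
    rewrite (f_src F') (f_tgt F'); congr (fob F' _); exact: e'.
  transitivity (comp E (adj_ext (adj_gen i)) (adj_ext (inl g)) e1).
    exact: (f_comp adj_ext e' e1).
  transitivity (comp E (F' (adj_gen i)) (F' (inl g)) e2); last first.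
    exact: (esym (f_comp F' e' e2)).
  by apply: comp_congr; rewrite ?Emor // F'gen; apply: adj_ext_gen.
Qed.
End Universal.
End Adjoin.

(* D_{n,K-1} together with the moment map on its objects.  An object *_i of
   C_{n,K-1} is encoded as [inr i] and an object j of [n] as [inl j].  The
   index k >= -1 is represented by K = k + 1 : nat; there are K.-1 = max(k, 0)
   objects *_i, and everything built on 'I_K is empty when k = -1. *)
Record stage (K n : nat) := Stage {
  stO : finType;
  stM : finType;
  stD : catStr stO stM;
  stmu : stO -> 'I_n.+1 + 'I_K.-1;
  (* h |-> p_{j,j+1} . h if the moment of h is j < n; h itself otherwise
     (in which case the value is irrelevant) *)
  ststep : stM -> stM;
  (* the inclusion of the objects of D_{0,K-1} = [K-1] *)
  stbase : 'I_K -> stO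
}.

Definition stage0 (K : nat) : stage K 0 :=
  @Stage K 0 'I_K (ordMor K) (ordStr K)
    (fun i => if insub (val i) is Some j then inr j else inl ord0) id id.

Section StageS.
Variables (K n : nat) (S : stage K n).

Definition adjIdx : finType := {h : stM S | stmu (tgt (stD S) h) == inl ord_max}.

Definition adjIdx_src (h : adjIdx) : stO S := src (stD S) (val h).

Definition widen_mu (x : 'I_n.+1 + 'I_K.-1) : 'I_n.+2 + 'I_K.-1 :=
  match x with
  | inl j => inl (widen_ord (leqnSn n.+1) j)
  | inr i => inr i
  end.

Definition stageS : stage K n.+1 :=
  @Stage K n.+1 _ _ (adjoin (stD S) adjIdx_src)
    (fun x => match x with
              | inl x => widen_mu (stmu x)
              | inr _ => inl ord_max
              end)
    (fun f => match f with
              | inl h => if insub h is Some i then adj_gen (stD S) adjIdx_src i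
                         else inl (ststep h)
              | inr _ => f
              end)
    (fun i => inl (stbase S i)).
End StageS.

Fixpoint stages (K n : nat) : stage K n :=
  match n with
  | 0 => stage0 K
  | n.+1 => stageS (stages K n)
  end.

Lemma src_ststep K n (h : stM (stages K n)) :
  src (stD (stages K n)) (ststep h) = src (stD (stages K n)) h.
Proof.
elim: n h => [//|n IH] [h|h] //=; case: insubP => [i _ <-|_] /=.
  by rewrite src_idm.
by rewrite IH.
Qed.

Lemma mu_ststep K n (h : stM (stages K n)) (j j' : 'I_n.+1) :
  stmu (tgt (stD (stages K n)) h) = inl j -> val j' = (val j).+1 ->
  stmu (tgt (stD (stages K n)) (ststep h)) = inl j'.
Proof.
elim: n h j j' => [|n IH] h j j'.
  by move=> _; case: j' => [[|[]]].
case: h => [h|h] /= Ej Ejj'; last first.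
  have : stmu (tgt (stD (stages K n.+1)) (inr h)) = inl ord_max by case: (h).
  rewrite /= Ej => -[] jn; move: (ltn_ord j'); by rewrite Ejj' jn /= ltnn.
case: insubP => [i /eqP Ei _|hN] /=.
  move: Ej; rewrite Ei => -[] ej; congr inl; apply: val_inj.
  by rewrite [RHS]Ejj' -ej.
case E: (stmu (tgt (stD (stages K n)) h)) Ej => [j0|//] [] ej.
have j0n : j0.+1 < n.+1.
  rewrite ltnS ltn_neqAle -ltnS ltn_ord andbT; apply: contra hN => /eqP j0n.
  by rewrite E; apply/eqP; congr inl; apply: val_inj.
rewrite (IH h j0 (Ordinal j0n) E erefl) /=; congr inl; apply: val_inj.
by rewrite [RHS]Ejj' -ej.
Qed.

(* The rooted action of C_{n,K-1} on D_{n,K-1}.  In [actD], the arrow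
   p_{i,j} acts by applying h |-> p_{l,l+1} . h  (j - i) times. *)
Section RAObj.
Variables n K : nat.

Definition catC : category := sumCat (ordCat n.+1) (discCat 'I_K.-1).

Definition catD : category := Category (stD (stages K n)).

Definition muD (h : Mor catD) : Ob catC := stmu (tgt catD h).

Definition actD (f : Mor catC) (h : Mor catD) : src catC f = muD h -> Mor catD :=
  fun _ => match f with
           | inl p => iter ((val p).2 - (val p).1) (@ststep _ _ _) h
           | inr _ => h
           end.

Lemma muD_iter r h (j j' : 'I_n.+1) : muD h = inl j -> val j' = val j + r ->
  muD (iter r (@ststep _ _ _) h) = inl j'.
Proof.
elim: r j' => [|r IH] j' Ej Ej'.
  by rewrite Ej; congr inl; apply: val_inj; rewrite Ej' addn0.
have jr : val j + r < n.+1.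
  by apply: ltn_trans (ltn_ord j'); rewrite Ej' addnS.
apply: (@mu_ststep _ _ _ (Ordinal jr)); last by rewrite Ej' addnS.
exact: IH.
Qed.

Definition actionD : action catC (Mor catD).
Proof.
refine (@Action catC (Mor catD) muD actD _ _ _).
- move=> [p|i] h /= e; last by [].
  by apply: muD_iter (esym e) _; rewrite subnKC // (valP p).
- move=> [p|i] [q|j] h //= e e1 e2 e3.
  have {}e : (val p).1 = (val q).2 by case: e.
  rewrite -iterD e addnBA ?subnK //; first by rewrite -e (valP p).
  exact: (valP q).
- move=> h; rewrite /actD; case: (muD h) => [j|i] //= _.
  by rewrite subnn.
Defined.

Definition ra_obj : rooted_action.
Proof.
refine (@RootedAction catC catD actionD _ _).
- by move=> g g' e /=; rewrite /muD tgt_comp.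
- move=> [p|i] h e //=; move: (_ - _) => r.
  by elim: r => [//|r IH]; rewrite iterS src_ststep IH.
Defined.
End RAObj.

(* The pair (n, K) stands for the object [n o (K - 1)]. *)
Definition DeltaDelta : category := full_RA (fun x : nat * nat => ra_obj x.1 x.2).

(* A map X of rooted actions is determined by the restrictions alpha of X^c to
   [n] and beta of X^d to D_{0,K-1}; only their object parts are needed. *)
Definition alpha (X : Mor DeltaDelta) (i : 'I_(src DeltaDelta X).1.+1) :
  Ob (catC (tgt DeltaDelta X).1 (tgt DeltaDelta X).2) :=
  fob (Fc (fm_map X)) (inl i).

Definition beta (X : Mor DeltaDelta) (i : 'I_(src DeltaDelta X).2) :
  Ob (catD (tgt DeltaDelta X).1 (tgt DeltaDelta X).2) :=
  fob (Fd (fm_map X)) (stbase _ i).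

Arguments alpha : clear implicits.
Arguments beta : clear implicits.

Definition DeltaDelta_plus (X : Mor DeltaDelta) : Prop :=
  injective (alpha X) /\ injective (beta X).

Definition DeltaDelta_minus (X : Mor DeltaDelta) : Prop :=
  (forall j : 'I_(tgt DeltaDelta X).1.+1, exists i, alpha X i = inl j) /\
  (forall y, exists x, fob (Fd (fm_map X)) x = y).

Definition DeltaDelta_deg (x : Ob DeltaDelta) : nat :=
  x.1 + #|stO (stages x.2 x.1)|.

Definition wide_subcategory (R : category) (P : Mor R -> Prop) : Prop :=
  (forall x, P (idm R x)) /\
  (forall g f (e : src R g = tgt R f), P g -> P f -> P (comp R g f e)).

Definition is_identity (R : category) (f : Mor R) : Prop :=
  exists x, f = idm R x.

Record is_reedy (R : category) (Rplus Rminus : Mor R -> Prop)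
    (d : Ob R -> nat) : Prop := IsReedy {
  reedy_wide_plus : wide_subcategory Rplus;
  reedy_wide_minus : wide_subcategory Rminus;
  reedy_raise : forall f, Rplus f -> ~ is_identity f ->
    d (src R f) < d (tgt R f);
  reedy_lower : forall f, Rminus f -> ~ is_identity f ->
    d (tgt R f) < d (src R f);
  reedy_factor : forall f, exists! p : Mor R * Mor R,
    [/\ Rminus p.1, Rplus p.2 &
        exists e : src R p.2 = tgt R p.1, f = comp R p.2 p.1 e]
}.

(* Main.v *)
From mathcomp Require Import all_boot.
From mathcomp Require Import boolp zify.
Require Import Defs.

Set Implicit Arguments.
Unset Strict Implicit.
Unset Printing Implicit Defensive.

(** The proof separates a formal part from the combinatorics of the categories
    [D_{n,k}].

    Formal part ([reedy_of_split_epi]).  Suppose that every minus map has a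
    section, that plus maps are monic and raise the degree unless they are
    identities, and that [g o f] in plus forces [f] in plus.  Then a section of
    a minus map is a plus map, so minus maps lower the degree; and two
    factorizations [q o p = q' o p'] are compared by [u = p' o s], with [s] a
    section of [p]: since [q' o u = q], the map [u] is a plus map.  By symmetry
    there is a plus map backwards, so the two middle objects have the same
    degree, [u] is an identity, and [p = p'] because [q] is monic.  What remains
    is to provide sections, cancellation, the degree inequality for plus maps,
    and one factorization of each map.

    Universal property ([ra_obj_ext], [ra_obj_uniq]).  Maps from
    [[n o k]] to any rooted action are the pairs of a functor [alpha] on [[n]]
    and a functor [beta] on [[k]] such that the moment of [beta k] is [alpha 0].
    This is proved by induction on the stages of [D_{n,k}], each of which is a
    free adjunction of arrows.  All the categories [C_{m,l}] and [D_{m,l}] are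
    posets, so maps between the objects [[n o k]] are pairs of monotone functions
    ([map_of_generators], [map_eq_on_generators]).

    Sections ([degeneracy_section]).  A minus map restricts to monotone
    surjections [[n] -> [m]] and [[k] -> [l]] ([minus_restrictions]), and
    monotone surjections have monotone sections.  A section of the first one
    fixing 0 and a section of the second one reaching the last element are
    compatible, hence define a section in the category of rooted actions.
    Conversely this shows that a pair of monotone surjections gives a map which
    is surjective on all objects of [D_{m,l}].  Factorizations
    ([plus_minus_factorization]) are therefore obtained by factoring [alpha] and
    [beta] separately through their images.

    Plus maps ([Fd_inj], [Fc_inj]).  The arrow [p_{i,j} . h] with [i < j]
    remembers [h] ([actD_tgt_inj]) and its target has moment [j], while moments
    grow strictly along non-identity arrows out of an object with moment in [[n]]
    ([arrow_stmu]).  Hence a map which is injective on [[n]] and on [[k]] is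
    injective on all objects of [C_{n,k}] and [D_{n,k}]; so it is monic and does
    not lower the degree.  If the degree is preserved then [alpha] is an injective
    monotone endomap of [[n]], hence the identity; thus the map is surjective on
    objects, restricts to a monotone bijection [[k] -> [l]], and is an
    identity ([plus_bijective_identity]). *)

(** * Reedy structures in which the minus maps split *)

Section Abstract.
Variables (R : category) (Rplus Rminus : Mor R -> Prop) (d : Ob R -> nat).
Hypothesis plus_wide : wide_subcategory Rplus.
Hypothesis minus_wide : wide_subcategory Rminus.
Hypothesis plus_cancel : forall g f (e : src R g = tgt R f),
  Rplus (comp R g f e) -> Rplus f.
Hypothesis plus_monic : forall q f g (e : src R q = tgt R f)
  (e' : src R q = tgt R g), Rplus q -> comp R q f e = comp R q g e' -> f = g.
Hypothesis plus_raise : forall f, Rplus f -> ~ is_identity f ->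
  d (src R f) < d (tgt R f).
Hypothesis minus_section : forall p, Rminus p ->
  exists s (e : src R p = tgt R s), comp R p s e = idm R (tgt R p).
Hypothesis factors : forall f, exists p q, [/\ Rminus p, Rplus q &
  exists e : src R q = tgt R p, f = comp R q p e].

Lemma plus_leq f : Rplus f -> d (src R f) <= d (tgt R f).
Proof.
move=> Pf; case: (EM (is_identity f)) => [[x ->]|/(plus_raise Pf)/ltnW//].
by rewrite src_idm tgt_idm.
Qed.

(** The comparison of two factorizations: [u] is [p'] after a section of [p], and
    it is a plus map because [q' o u = q] is one. *)
Lemma minus_compare p q p' q' (e : src R q = tgt R p)
    (e' : src R q' = tgt R p') : Rminus p -> Rplus q -> 
  comp R q p e = comp R q' p' e' ->
  exists u (eu : src R q' = tgt R u),
    [/\ Rplus u, src R u = tgt R p, tgt R u = tgt R p' & comp R q' u eu = q].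
Proof.
move=> Mp Pq E; have [s [es Es]] := minus_section Mp.
have sp : src R p' = src R p by rewrite -(src_comp e') -E src_comp.
have eu : src R p' = tgt R s by rewrite sp.
have tu := tgt_comp eu.
have eq' : src R q' = tgt R (comp R p' s eu) by rewrite tu.
have e1 : src R (comp R q' p' e') = tgt R s by rewrite src_comp.
have e1' : src R (comp R q p e) = tgt R s by rewrite src_comp.
have e2 : src R q = tgt R (comp R p s es) by rewrite tgt_comp.
have Eq : comp R q' (comp R p' s eu) eq' = q.
  rewrite (comp_assoc eq' e1) (comp_congr (g' := comp R q p e) e1 e1') //.
  rewrite -(comp_assoc e2 e1').
  have e3 : src R q = tgt R (idm R (tgt R p)) by rewrite tgt_idm.
  by rewrite (comp_congr e2 e3) // comp_idrE.
exists (comp R p' s eu), eq'; split=> //.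
  by apply: (plus_cancel (e := eq')); rewrite Eq.
by rewrite src_comp -(src_comp es) Es src_idm.
Qed.

(** A section of a non-identity minus map is a non-identity plus map in the
    opposite direction, so the degree condition on minus maps follows from the
    one on plus maps; and [minus_compare], used in both directions, identifies
    any two factorizations. *)
Theorem reedy_of_split_epi : is_reedy Rplus Rminus d.
Proof.
split=> //.
- move=> p Mp Nid; have [s [e E]] := minus_section Mp.
  have ss : src R s = tgt R p by rewrite -(src_comp e) E src_idm.
  have Ps : Rplus s by apply: (plus_cancel (e := e)); rewrite E; apply: plus_wide.1.
  rewrite -ss e; apply: plus_raise => // -[x Ex]; apply: Nid.
  by subst s; rewrite comp_idrE in E; exists (tgt R p).
move=> f; have [p [q [Mp Pq [e Ef]]]] := factors f.
exists (p, q); split=> [|[p' q'] /= [Mp' Pq' [e' Ef']]]; first by split=> //; exists e.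
have E : comp R q p e = comp R q' p' e' by rewrite -Ef.
have [u [eu [Pu su tu Eu]]] := minus_compare Mp Pq E.
have [v [ev [Pv sv tv Ev]]] := minus_compare Mp' Pq' (esym E).
have le : d (tgt R p') <= d (tgt R p) by rewrite -sv -tv plus_leq.
have [x Ex] : is_identity u.
  by apply: contrapT => /(plus_raise Pu); rewrite su tu ltnNge le.
have Eq : q = q' by subst u; rewrite comp_idrE in Eu.
clear Ev; subst q'; congr pair; apply: plus_monic Pq E.
Qed.
End Abstract.

(** * Thin categories and monotone functions *)

(** In the categories of interest this relation carries all the information: it is
    a partial order, and functors between them are monotone functions. *)
Definition arrow (C : category) (x y : Ob C) :=
  exists2 f, src C f = x & tgt C f = y.

Definition thin (C : category) := forall f g : Mor C,
  src C f = src C g -> tgt C f = tgt C g -> f = g.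

Definition arrow_antisymmetric (C : category) := forall x y : Ob C,
  arrow x y -> arrow y x -> x = y.

Lemma arrow_refl (C : category) (x : Ob C) : arrow x x.
Proof. by exists (idm C x); rewrite (src_idm, tgt_idm). Qed.

Lemma arrow_trans (C : category) (y x z : Ob C) :
  arrow x y -> arrow y z -> arrow x z.
Proof.
move=> [f <- tf] [g sg <-]; have e : src C g = tgt C f by rewrite sg tf.
by exists (comp C g f e); rewrite (src_comp, tgt_comp).
Qed.

Lemma arrow_fob (C D : category) (F : functor C D) x y :
  arrow x y -> arrow (fob F x) (fob F y).
Proof. by move=> [f <- <-]; exists (F f); rewrite (f_src, f_tgt). Qed.

Lemma arrow_ord N (i j : Ob (ordCat N)) : arrow i j <-> i <= j.
Proof.
split=> [[f <- <-]|le_ij]; first exact: (valP f).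
by exists (ord_arr le_ij).
Qed.

Lemma thin_functor_eq (C D : category) (F G : functor C D) : thin D ->
  fob F =1 fob G -> F = G.
Proof.
move=> tD E; have Eo : fob F = fob G by apply: funext.
apply: functor_eq => //; apply: funext => f.
by apply: tD; rewrite !(f_src, f_tgt) Eo.
Qed.

(** Thinness makes every choice of arrows functorial. *)
Lemma functor_of_mono N (E : category) (a : 'I_N -> Ob E) : thin E ->
  (forall i j : 'I_N, i <= j -> arrow (a i) (a j)) ->
  exists F : functor (ordCat N) E, fob F =1 a.
Proof.
move=> tE mono.
have [m m_src m_tgt] : exists2 m : Mor (ordCat N) -> Mor E,
    forall f, src E (m f) = a (src (ordCat N) f) &
    forall f, tgt E (m f) = a (tgt (ordCat N) f).
  have arr (f : Mor (ordCat N)) :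
      {g | src E g = a (src (ordCat N) f) & tgt E g = a (tgt (ordCat N) f)}.
    exact/cid2/mono/(valP f).
  by exists (fun f => s2val (arr f)) => f; case: (arr f).
have m_idm x : m (idm (ordCat N) x) = idm E (a x).
  by apply: tE; rewrite ?m_src ?m_tgt ?src_idm ?tgt_idm.
have m_comp g f (e : src (ordCat N) g = tgt (ordCat N) f)
    (e' : src E (m g) = tgt E (m f)) :
    m (comp (ordCat N) g f e) = comp E (m g) (m f) e'.
  by apply: tE; rewrite ?src_comp ?tgt_comp ?m_src ?m_tgt ?src_comp ?tgt_comp.
by exists (Functor m_src m_tgt m_idm m_comp).
Qed.

(** The image of a finite chain in a poset, listed without repetition, is again a
    chain: [q] enumerates it and [p] sends [i] to the rank of [a i]. *)
Lemma mono_image (O : eqType) (M : Type) (S : catStr O M) N (a : 'I_N -> O) :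
  arrow_antisymmetric (Category S) ->
  (forall i j : 'I_N, i <= j -> @arrow (Category S) (a i) (a j)) ->
  exists r (p : 'I_N -> 'I_r) (q : 'I_r -> O),
    [/\ a =1 q \o p, injective q, forall j, exists i, p i = j,
        {homo p : i j / i <= j} & 
        forall i j : 'I_r, i <= j -> @arrow (Category S) (q i) (q j)].
Proof.
move=> asym mono; pose s := undup [seq a i | i <- enum 'I_N].
pose le x y := `[< @arrow (Category S) x y >].
have le_refl : reflexive le by move=> x; apply/asboolP/arrow_refl.
have le_trans : transitive le.
  move=> y x z /asboolP xy /asboolP yz; apply/asboolP.
  exact: (@arrow_trans (Category S) y).
have s_le : sorted le s.
  apply: (subseq_sorted le_trans (undup_subseq _)).
  rewrite sorted_map; apply: (@sub_sorted _ (relpre val leq)).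
    by move=> i j /= /mono ?; apply/asboolP.
  by rewrite -sorted_map val_enum_ord iota_sorted.
have a_s i : a i \in s by rewrite mem_undup map_f // mem_enum.
have [r Er] : {r | r = size s} by exists (size s).
have idx i : index (a i) s < r by rewrite Er index_mem.
pose p i := Ordinal (idx i).
(* An element of the chain serves as default for [nth], so the empty chain is
   treated apart. *)
case: r => [|r] in Er idx p *.
  exists 0, p, (fun j : 'I_0 => match notF (ltn_ord j) with end).
  by split=> [i|[]|[]|i|[]] //; have := idx i.
have i0 : 'I_N.
  by case: N a @s Er {mono s_le a_s idx p} => [|N] a /=; [rewrite enum_ord0 | exists 0].
pose q (j : 'I_r.+1) := nth (a i0) s j.
have q_le (i j : 'I_r.+1) : i <= j -> le (q i) (q j).
  by move=> ij; apply: (sorted_leq_nth le_trans le_refl); rewrite // inE -Er.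
have qp : a =1 q \o p by move=> i; rewrite /q /= nth_index.
exists r.+1, p, q; split=> //.
- move=> i j /eqP; rewrite nth_uniq ?undup_uniq -?Er // => /eqP.
  exact: val_inj.
- move=> j; have : q j \in s by rewrite mem_nth // -Er.
  rewrite mem_undup => /mapP[i _ Ei]; exists i; apply: val_inj.
  by rewrite /= -Ei index_uniq ?undup_uniq // -Er.
- move=> i j ij /=; rewrite leqNgt; apply/negP => lt.
  have /asboolP ji := sorted_leq_index le_trans le_refl s_le _ _ (a_s j) (a_s i) (ltnW lt).
  by rewrite (asym _ _ ji (mono _ _ ij)) ltnn in lt.
- by move=> i j /q_le/asboolP.
Qed.

(** Any section of a monotone surjection between chains is monotone, so its value
    over the image of one point [x0] can be prescribed; there is no such point
    when [N = 0]. *)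
Lemma mono_section N r (p : 'I_N -> 'I_r) (x0 : option 'I_N) :
  (forall j, exists i, p i = j) -> {homo p : i j / i <= j} ->
  exists s : 'I_r -> 'I_N, [/\ cancel s p, {homo s : i j / i <= j} &
    forall x, x0 = Some x -> s (p x) = x].
Proof.
move=> surj mono.
have [s0 s0K] : exists s0, cancel s0 p 
  by exists (fun j => projT1 (cid (surj j))) => j; case: cid.
pose s j := if x0 is Some x then if j == p x then x else s0 j else s0 j.
have sK : cancel s p.
  by rewrite /s => j; case: (x0) => [x|//]; case: eqP => [->|].
exists s; split=> //.
- move=> i j ij; rewrite leqNgt; apply/negP => lt.
  have /mono := ltnW lt; rewrite !sK => ji.
  have Eij : i = j by apply: val_inj; apply/anti_leq; rewrite ij.
  by rewrite Eij ltnn in lt.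
- by move=> x Ex; rewrite /s Ex eqxx.
Qed.

(** Written with predecessors because the chain [[k]] is ['I_K] with [K = k + 1],
    which is empty for [k = -1]. *)
Lemma last_surj N r (p : 'I_N -> 'I_r) (i : 'I_N) :
  (forall j, exists i, p i = j) -> {homo p : i j / i <= j} ->
  val i = N.-1 -> val (p i) = r.-1.
Proof.
move=> surj mono Ei; have r_gt0 : 0 < r by case: (p i) => x; apply: leq_ltn_trans.
have lr : r.-1 < r by rewrite prednK.
have [j Ej] := surj (Ordinal lr).
have : p j <= p i by apply: mono; rewrite Ei -ltnS prednK // (leq_ltn_trans _ (ltn_ord i)).
rewrite Ej /=; move: (ltn_ord (p i)); lia.
Qed.

Lemma first_surj N r (p : 'I_N.+1 -> 'I_r.+1) :
  (forall j, exists i, p i = j) -> {homo p : i j / i <= j} -> p ord0 = ord0.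
Proof.
move=> surj mono; have [i Ei] := surj ord0; apply: val_inj; apply/eqP.
by rewrite -leqn0 -[X in _ <= X]/(val (@ord0 r)) -Ei mono.
Qed.

(** * The categories C_{n,k} and D_{n,k} are posets *)

Lemma ordCat_thin N : thin (ordCat N).
Proof. by move=> f g; apply: ordMor_eq. Qed.

Lemma ordCat_antisym N : arrow_antisymmetric (ordCat N).
Proof.
move=> i j /arrow_ord ij /arrow_ord ji; apply: val_inj.
by apply/anti_leq; rewrite ij.
Qed.

Lemma catC_thin n K : thin (catC n K).
Proof.
move=> [f|f] [g|g] //= [e1]; last by rewrite e1.
by move=> [e2]; congr inl; apply: ordCat_thin.
Qed.

Lemma arrow_catC n K (x y : Ob (catC n K)) : arrow x y <->
  match x, y return Prop with
  | inl i, inl j => i <= j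
  | inr i, inr j => i = j
  | _, _ => False
  end.
Proof.
split; first by move=> [[f|f] <- <-] //=; apply: (valP f).
case: x y => [i|i] [j|j] // => [ij|->]; last by exists (inr j).
by exists (inl (ord_arr ij)).
Qed.

Lemma catC_antisym n K : arrow_antisymmetric (catC n K).
Proof.
move=> [i|i] [j|j] /arrow_catC ij /arrow_catC ji //; last by rewrite ij.
by congr inl; apply: val_inj; apply/anti_leq; rewrite ij.
Qed.

Section Adjoin.
Variables (O M I : finType) (D : catStr O M) (s : I -> O).

Lemma adjoin_thin : thin (Category D) -> thin (Category (adjoin D s)).
Proof.
move=> tD [f|[i|[[i f] /= tf]]] [g|[j|[[j g] /= tg]]] //= [e1] [e2].
- by congr inl; apply: tD.
- by rewrite e1.
- subst j; congr (inr (inr _)); apply: val_inj => /=; congr pair; apply: tD => //=.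
  by rewrite (eqP tf) (eqP tg).
Qed.

(** The new object [i] becomes a leaf attached to [s i]. *)
Lemma adjoin_arrow (x y : adjOb O I) :
  @arrow (Category (adjoin D s)) x y <->
  match x, y with
  | inl x, inl y => @arrow (Category D) x y
  | inl x, inr i => @arrow (Category D) x (s i)
  | inr i, inr j => i = j
  | inr _, inl _ => False
  end.
Proof.
split.
  move=> [[f|[i|[[i f] /= tf]]] <- <-] //=; first by exists f.
  by exists f; last exact: (eqP tf).
case: x y => [x|i] [y|j] //.
- by move=> [f <- <-]; exists (inl f).
- by move=> [f <- tf]; exists (adj_new tf).
- by move=> ->; exists (inr (inl j)).
Qed.
End Adjoin.

Lemma catD_thin n K : thin (catD n K).
Proof.
by elim: n => [|n IH]; [apply: ordCat_thin | apply: adjoin_thin].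
Qed.

Lemma catD_antisym n K : arrow_antisymmetric (catD n K).
Proof.
elim: n => [|n IH]; first exact: ordCat_antisym.
move=> [x|i] [y|j] /adjoin_arrow xy /adjoin_arrow yx //; last by rewrite xy.
by congr inl; apply: IH.
Qed.

(** New objects are only attached as targets, so [[k]] stays closed under
    predecessors in every stage. *)
Lemma arrow_base n K (x : Ob (catD n K)) (j : 'I_K) :
  arrow x (stbase (stages K n) j) ->
  exists2 i : 'I_K, x = stbase (stages K n) i & i <= j.
Proof.
elim: n x => [|n IH] x /=.
  by move=> /arrow_ord ij; exists x.
by case: x => [x|i] /adjoin_arrow // /IH[i -> ij]; exists i.
Qed.

Lemma stbase_arrow n K (i j : 'I_K) :
  i <= j -> @arrow (catD n K) (stbase (stages K n) i) (stbase (stages K n) j).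
Proof.
by elim: n => [|n IH] ij; [apply/arrow_ord | apply/adjoin_arrow/IH].
Qed.

Lemma stbase_inj n K : injective (stbase (stages K n)).
Proof. by elim: n => [|n IH] i j // [/IH]. Qed.

Lemma stmu_base n K (j : 'I_K) : stmu (stbase (stages K n) j) =
  if insub (val j) is Some i then inr i else inl ord0.
Proof.
elim: n => [//|n IH] /=; rewrite IH; case: insubP => //= _.
by congr inl; apply: val_inj.
Qed.

Lemma stmu_star n K (i : 'I_K.-1) :
  stmu (stbase (stages K n) (widen_ord (leq_pred K) i)) = inr i.
Proof.
rewrite stmu_base; case: insubP => [j _ Ej|]; last by rewrite /= ltn_ord.
by congr inr; apply: val_inj.
Qed.

Lemma stmu_last n K (j : 'I_K) : val j = K.-1 ->
  stmu (stbase (stages K n) j) = inl ord0.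
Proof. by move=> Ej; rewrite stmu_base insubF // Ej ltnn. Qed.

(** Objects whose moment is a star or 0 are those of [D_{0,k}], and the moment
    determines them; an object adjoined at stage [j > 0] has moment [j]. *)
Lemma stmu_cases n K (x : Ob (catD n K)) :
  [\/ exists2 i, x = stbase (stages K n) (widen_ord (leq_pred K) i) & stmu x = inr i,
     exists2 j : 'I_K, x = stbase (stages K n) j & val j = K.-1 /\ stmu x = inl ord0 |
     exists2 j, stmu x = inl j & 0 < val j].
Proof.
elim: n x => [|n IH].
  move=> /= x; case: insubP => [i lt Ei|ge].
    by constructor 1; exists i => //; apply: val_inj.
  constructor 2; exists x => //; split=> //; move: (ltn_ord x) ge; lia.
case=> [x|i] /=; last by constructor 3; exists ord_max.
case: (IH x) => [[i Ei ->]|[j Ej [lj ->]]|[j -> j0]].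
- by constructor 1; exists i; rewrite // Ei.
- constructor 2; exists j; rewrite ?Ej //; split=> //.
  by congr inl; apply: val_inj.
- by constructor 3; exists (widen_ord (leqnSn n.+1) j).
Qed.

Lemma stmu_starP n K (x : Ob (catD n K)) i : stmu x = inr i ->
  x = stbase (stages K n) (widen_ord (leq_pred K) i).
Proof.
case: (stmu_cases x) => [[j Ej ->]|[j _ [_ ->]]|[j -> _]] // [<-].
exact: Ej.
Qed.

Lemma stmu_zeroP n K (x : Ob (catD n K)) : stmu x = inl ord0 ->
  exists2 j : 'I_K, x = stbase (stages K n) j & val j = K.-1.
Proof.
case: (stmu_cases x) => [[j _ ->]|[j Ej [lj _]]|[j -> lt]] //.
  by exists j.
by move=> [ej]; rewrite ej in lt.
Qed.

(** A new object of stage [n] hangs below the source of some [h] of moment [n - 1]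
    that lies in the previous stage, where moments are smaller than [n]; and the
    only object of moment 0 is the last one of [[k]], so no arrow of [[k]] leaves
    it. *)
Lemma arrow_stmu n K (x y : Ob (catD n K)) (c : 'I_n.+1) : arrow x y ->
  stmu x = inl c -> x = y \/ exists2 d, stmu y = inl d & c < d.
Proof.
elim: n x y c => [|n IH].
  move=> x y c xy Ex; left; apply: ordCat_antisym => //.
  have [|j -> lj] := @stmu_zeroP 0 K x; first by rewrite Ex (ord1 c).
  apply/arrow_ord; rewrite /= lj; move: (ltn_ord y); lia.
have widenP (z : Ob (catD n K)) (e : 'I_n.+2) :
    widen_mu (stmu z) = inl e -> exists2 e0, stmu z = inl e0 & val e0 = val e.
  by case: (stmu z) => [e0|//] [<-]; exists e0.
move=> [x|i] [y|j] c /adjoin_arrow //=; last by move=> ->; left.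
- move=> xy /widenP[c0 Ex <-]; have [->|[d Ey lt]] := IH _ _ _ xy Ex; first by left.
  by right; rewrite Ey; exists (widen_ord (leqnSn n.+1) d).
- move=> _ /widenP[c0 _ <-]; right; exists ord_max => //=.
Qed.

Lemma arrow_stmu_eq n K (x y : Ob (catD n K)) : arrow x y ->
  stmu x = stmu y -> x = y.
Proof.
move=> xy Exy; case Ex: (stmu x) => [c|i].
  have [//|[d]] := arrow_stmu xy Ex; rewrite -Exy Ex => -[->].
  by rewrite ltnn.
by rewrite (stmu_starP Ex) -(@stmu_starP _ _ y i) // -Exy.
Qed.

(** When [j] is the largest index of the current stage, [p_{j,j+1} . h] is the
    generator whose target is the object labelled by [h]; otherwise the step was
    taken in an earlier stage. *)
Lemma ststep_inj n K (h h' : Mor (catD n K)) (j : 'I_n.+1) : j < n ->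
  stmu (tgt (catD n K) h) = inl j -> stmu (tgt (catD n K) h') = inl j ->
  tgt (catD n K) (ststep h) = tgt (catD n K) (ststep h') -> h = h'.
Proof.
elim: n h h' j => [//|n IH] h h' j lt_jn.
have old (g : Mor (catD n.+1 K)) : stmu (tgt (catD n.+1 K) g) = inl j ->
    exists2 g0, g = inl g0 & 
    if stmu (tgt (catD n K) g0) == inl ord_max
    then exists2 i : adjIdx _, val i = g0 & ststep g = adj_gen _ (@adjIdx_src _ _ _) i
    else ststep g = inl (ststep g0) /\
       exists2 j0, stmu (tgt (catD n K) g0) = inl j0 & val j0 = val j /\ j0 < n.
  case: g => [g Eg|g]; last first.
    have -> : stmu (tgt (catD n.+1 K) (inr g)) = inl ord_max by case: g.
    by move=> [ej]; move: lt_jn; rewrite -ej /= ltnn.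
  exists g => //; case: eqP => [E|NE] /=.
    case: insubP => [i _ Ei|]; last by rewrite E eqxx.
    by exists i.
  case: insubP => [i /eqP//|_]; split=> //.
  move: Eg => /=; case E: (stmu (tgt _ g)) => [j0|//] [ej].
  exists j0 => //; split; first by rewrite -ej.
  rewrite ltn_neqAle -ltnS ltn_ord andbT; apply/eqP => j0n.
  by apply: NE; rewrite /= E; congr inl; apply: val_inj.
move=> /old[g -> {h}] Hg /old[g' -> {h'}] Hg'.
move: Hg Hg'; case: eqP => E; case: eqP => E'.
- by move=> [i <- ->] [i' <- ->] /= [->].
- by move=> [i <- ->] [-> _].
- by move=> [-> _] [i <- ->].
- move=> [-> [j0 Ej0 [ej0 lt0]]] [-> [j1 Ej1 [ej1 lt1]]] [] /IH IH'.
  congr inl; apply: (IH' j0) => //; rewrite Ej1; congr inl; apply: val_inj.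
  by rewrite /= ej0 ej1.
Qed.

(** For a non-identity arrow [f] of [[n]], the last of the steps making up
    [f . h] determines the preceding arrow by [ststep_inj], and so on down to [h]. *)
Lemma actD_tgt_inj n K (f : Mor (catC n K)) h h' 
  (e : src (catC n K) f = muD h) (e' : src (catC n K) f = muD h') :
  src (catC n K) f <> tgt (catC n K) f ->
  tgt (catD n K) (actD e) = tgt (catD n K) (actD e') -> h = h'.
Proof.
case: f e e' => [p|//] /= e e' Np.
have lt_p : (val p).1 < (val p).2.
  rewrite ltn_neqAle (valP p) andbT; apply/eqP => E; apply: Np; congr inl.
  exact: val_inj.
have {Np} Ed : (val p).2 = (val p).1 + ((val p).2 - (val p).1) :> nat.
  by rewrite subnKC // (valP p).
case Er: ((val p).2 - (val p).1) Ed => [|r]; first by lia.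
elim: r {Er} (val p).2 {lt_p} => [|r IH] y Ey.
  move=> E; apply: ststep_inj (esym e) (esym e') E.
  by move: (ltn_ord y); rewrite Ey addn1.
have lt_c : (val p).1 + r.+1 < n.+1.
  by move: (ltn_ord y); rewrite Ey addnS; apply: ltnW.
move=> E; apply: (IH (Ordinal lt_c)) => //; congr tgt; move: E.
have mi g : inl (val p).1 = muD g ->
    stmu (tgt (catD n K) (iter r.+1 (@ststep _ _ (stages K n)) g)) = inl (Ordinal lt_c).
  by move=> eg; apply: muD_iter (esym eg) _.
rewrite 2![in X in X -> _]iterS; apply: ststep_inj (mi _ e) (mi _ e').
by move: (ltn_ord y); rewrite Ey addnS.
Qed.

(** * The universal property of the objects *)

Lemma mu_idm (Y : rooted_action) (g : Mor (raD Y)) :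
  mu Y (idm (raD Y) (tgt (raD Y) g)) = mu Y g.
Proof.
have e : src (raD Y) (idm (raD Y) (tgt (raD Y) g)) = tgt (raD Y) g.
  by rewrite src_idm.
by rewrite -(mu_rooted e) comp_idl.
Qed.

(** The moment of a morphism is that of its target, as for the identity of that
    target. *)
Lemma mu_tgt (Y : rooted_action) (f g : Mor (raD Y)) :
  tgt (raD Y) f = tgt (raD Y) g -> mu Y f = mu Y g.
Proof. by move=> E; rewrite -mu_idm E mu_idm. Qed.

Lemma act_congr (Y : rooted_action) f g f' g' (e : src (raC Y) f = mu Y g)
  (e' : src (raC Y) f' = mu Y g') : f = f' -> g = g' -> act Y f g e = act Y f' g' e'.
Proof. by move=> ef eg; subst f' g'; apply: ra_id_act. Qed.

Lemma fmor_congr (C D : category) (F G : functor C D) : F = G -> forall f, F f = G f.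
Proof. by move=> ->. Qed.

Lemma fob_congr (C D : category) (F G : functor C D) :
  F = G -> forall x, fob F x = fob G x.
Proof. by move=> ->. Qed.

Section StageMap.
Variables (K : nat) (Y : rooted_action) (p : nat -> Mor (raC Y)).

(** Compatibility of a functor on the [n]-th stage with moments and with the
    actions of [p_{j,j+1}] for [j < n].  The images [p j] form a sequence
    indexed by [nat] so that one sequence serves all stages at once; at stage [n]
    only the source of [p n] matters. *)
Definition stage_map n (F : functor (catD n K) (raD Y)) := forall h (j : 'I_n.+1),
  stmu (tgt (catD n K) h) = inl j ->
  mu Y (F h) = src (raC Y) (p j) /\
  (j < n -> exists e, F (ststep h) = act Y (p j) (F h) e).

Definition stage_incl n : functor (catD n K) (catD n.+1 K) :=
  adj_incl (stD (stages K n)) (@adjIdx_src _ _ (stages K n)).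

Fixpoint base_functor n : functor (ordCat K) (catD n K) :=
  match n return functor (ordCat K) (catD n K) with
  | 0 => idF (ordCat K)
  | n.+1 => compF (stage_incl n) (base_functor n)
  end.

Lemma base_ob n : fob (base_functor n) = stbase (stages K n).
Proof. by elim: n => //= n ->. Qed.

Lemma ststep_incl n (h : Mor (catD n K)) (j : 'I_n.+1) : j < n ->
  stmu (tgt (catD n K) h) = inl j -> ststep (stage_incl n h) = stage_incl n (ststep h).
Proof.
move=> lt Ej /=; case: insubP => // i /eqP Ei.
by move: lt; move: Ei; rewrite Ej => -[->]; rewrite /= ltnn.
Qed.

Lemma ststep_gen n (i : adjIdx (stages K n)) :
  ststep (stage_incl n (val i)) = adj_gen _ (@adjIdx_src _ _ (stages K n)) i.
Proof. by rewrite /= valK. Qed.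

Lemma stage_map_incl n (F : functor (catD n.+1 K) (raD Y)) :
  stage_map F -> stage_map (compF F (stage_incl n)).
Proof.
move=> SF h j Ej; have [|m s] := SF (stage_incl n h) (widen_ord (leqnSn _) j).
  by rewrite /= Ej.
split=> [|lt]; first exact: m.
have [|e E] := s; first by rewrite /= ltnW.
exists e; rewrite -E; congr (fmor F _); exact: (esym (ststep_incl lt Ej)).
Qed.

(** The value on each generating arrow [p_{n,n+1} . h] is forced by that on [h]. *)
Lemma stage_map_eq n (F G : functor (catD n K) (raD Y)) :
  stage_map F -> stage_map G ->
  compF F (base_functor n) = compF G (base_functor n) -> F = G.
Proof.
elim: n F G => [|n IH] F G SF SG E.
  apply: functor_eq; apply: funext => x.
    exact: (fob_congr E x).
  exact: (fmor_congr E x).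
have {IH}EFG : compF F (stage_incl n) = compF G (stage_incl n).
  apply: IH; try exact: stage_map_incl.
  apply: functor_eq; apply: funext => x.
    exact: (fob_congr E x).
  exact: (fmor_congr E x).
have gen i : F (adj_gen _ (@adjIdx_src _ _ (stages K n)) i) = 
             G (adj_gen _ (@adjIdx_src _ _ (stages K n)) i).
  have Ei : stmu (tgt (catD n.+1 K) (stage_incl n (val i))) =
      inl (widen_ord (leqnSn n.+1) ord_max).
    by rewrite /= (eqP (valP i)).
  have [|eF EF] := (SF _ _ Ei).2; first exact: ltnSn.
  have [|eG EG] := (SG _ _ Ei).2; first exact: ltnSn.
  rewrite -ststep_gen EF EG; apply: act_congr => //.
  exact: (fmor_congr EFG (val i)).
have sa i : src (raD Y) (F (adj_gen _ (@adjIdx_src _ _ (stages K n)) i)) =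
   fob (compF F (stage_incl n)) (adjIdx_src i).
  rewrite f_src; congr (fob F _); by rewrite /= src_idm.
have [H [_ uniqH]] := adjoin_universal sa.
transitivity H; [apply: esym|]; apply: uniqH; split=> //.
Qed.

Hypothesis p_chain : forall j, src (raC Y) (p j.+1) = tgt (raC Y) (p j).

(** The extension to a new stage sends the generating arrow [p_{n,n+1} . h] to
    [p n . F h]; it starts at the source of [F h], as [adj_ext] requires, because
    the action on the target is rooted. *)
Lemma stage_map_exists n (b : functor (ordCat K) (raD Y)) :
  (forall h, val (tgt (ordCat K) h) = K.-1 -> mu Y (b h) = src (raC Y) (p 0)) ->
  exists F : functor (catD n K) (raD Y), stage_map F /\ compF F (base_functor n) = b.
Proof.
move=> b0; elim: n => [|n [F [SF Fb]]].
  exists b; split; last by apply: functor_eq.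
  move=> h j Ej; split; last by [].
  rewrite (ord1 j) in Ej *; have [i Ei li] := @stmu_zeroP 0 K _ Ej.
  apply: b0; exact: (etrans (f_equal val Ei) li).
pose s := @adjIdx_src _ _ (stages K n).
have ea (i : adjIdx (stages K n)) : src (raC Y) (p n) = mu Y (F (val i)).
  by have [] := SF _ _ (eqP (valP i)).
pose a i := act Y (p n) (F (val i)) (ea i).
have sa i : src (raD Y) (a i) = fob F (s i).
  by rewrite src_rooted f_src.
have ma i : mu Y (a i) = src (raC Y) (p n.+1) by rewrite mu_act p_chain.
pose F' : functor (catD n.+1 K) (raD Y) := adj_ext sa.
have Eincl : compF F' (stage_incl n) = F by apply: functor_eq.
exists F'; split; last first.
  rewrite -[RHS]Fb -Eincl; exact: functor_eq.
case=> [h|h] j Ej; last first.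
  have lj : j = ord_max by case: h Ej => [i|q] /= [<-].
  rewrite lj; split=> [|]; last by rewrite ltnn.
  case: h {Ej} => [i|q] /=; first by rewrite mu_idm ma.
  by rewrite mu_rooted ma.
move: Ej => /=; case Ej0: (stmu (tgt (stD (stages K n)) h)) => [j0|//] [<-].
have [m st] := SF _ _ Ej0; split; first exact: m.
move=> _; case: (ltnP j0 n) => [lt|ge].
  have [e E] := st lt; exists e; rewrite -[RHS]E.
  have := ststep_incl lt Ej0; rewrite /= => ->; by [].
have Ej0n : j0 = ord_max by apply/val_inj/anti_leq; rewrite ge -ltnS ltn_ord.
case: insubP => [i _ Ei|]; last by rewrite Ej0 Ej0n eqxx.
have e : src (raC Y) (p j0) = mu Y (F h) by rewrite m.
exists e; transitivity (a i); first exact: adj_ext_gen.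
by apply: act_congr; rewrite ?Ei // Ej0n.
Qed.
End StageMap.

Section Chain.
Variables (n : nat) (C : category) (A : functor (ordCat n.+1) C).

(** Truncation at [n] prolongs the chain [0 <= ... <= n] by identities, which turns
    a functor on [[n]] into a sequence of arrows indexed by [nat]. *)
Lemma inord_leq j : @inord n (minn j n) <= @inord n (minn j.+1 n).
Proof. by rewrite !inordK ?ltnS ?geq_minr //; lia. Qed.

Definition step_arr j : Mor C := A (ord_arr (inord_leq j)).

Lemma step_src j : src C (step_arr j) = fob A (inord (minn j n)).
Proof. by rewrite f_src. Qed.

Lemma step_tgt j : tgt C (step_arr j) = fob A (inord (minn j.+1 n)).
Proof. by rewrite f_tgt. Qed.
End Chain.

Section Copair.
Variables (C E : category) (T : Type) (A : functor C E) (s : T -> Ob E).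

Definition copair_ob (x : Ob (sumCat C (discCat T))) : Ob E :=
  match x with inl x => fob A x | inr i => s i end.

Definition copair_mor (f : Mor (sumCat C (discCat T))) : Mor E :=
  match f with inl f => A f | inr i => idm E (s i) end.

Definition copair : functor (sumCat C (discCat T)) E.
Proof.
refine (@Functor _ _ copair_ob copair_mor _ _ _ _).
- by case=> f /=; rewrite ?f_src ?src_idm.
- by case=> f /=; rewrite ?f_tgt ?tgt_idm.
- by case=> x /=; rewrite ?f_idm.
- move=> [g|g] [f|f] e e' //=; first exact: f_comp.
  have Egf : g = f by case: e.
  by subst g; rewrite comp_idlE.
Defined.
End Copair.

Definition inlF (C D : category) : functor C (sumCat C D).
Proof.
refine (@Functor C (sumCat C D) inl inl _ _ _ _) => //=.
by move=> g f e e'; congr inl; apply: comp_irr.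
Defined.

(** A map of rooted actions preserves the action of [p_{j,j+1}], which is a
    single step. *)
Lemma ra_stage_map n K Y (X : ra_mor (ra_obj n K) Y) :
  stage_map (step_arr (compF (Fc X) (inlF _ _))) (Fd X).
Proof.
move=> h j Ej; split.
  rewrite step_src; apply: etrans (ra_mu X h) _; congr (fob _ _); rewrite [LHS]Ej /=; congr inl.
  by rewrite (minn_idPl _) ?inord_val // -ltnS.
move=> lt; pose f := ord_arr (@inord_leq n j).
have jE : inord (minn j n) = j by rewrite (minn_idPl _) ?inord_val // -ltnS.
have e : src (raC (ra_obj n K)) (inl f) = mu (ra_obj n K) h.
  by rewrite [RHS]Ej /= jE.
have e' : src (raC Y) (Fc X (inl f)) = mu Y (Fd X h) by rewrite f_src ra_mu e.
exists e'; rewrite -(ra_act X e e'); congr (fmor _ _) => /=.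
rewrite (_ : nat_of_ord (inord _) - nat_of_ord (inord _) = 1) // !inordK; lia.
Qed.

(** The star [*_i] is the moment of the object [i] of [[k]], so its image is
    forced as well. *)
Theorem ra_obj_uniq n K Y (X X' : ra_mor (ra_obj n K) Y) :
  compF (Fc X) (inlF _ _) = compF (Fc X') (inlF _ _) ->
  compF (Fd X) (base_functor K n) = compF (Fd X') (base_functor K n) -> X = X'.
Proof.
move=> EA EB; have EFd : Fd X = Fd X'.
  apply: stage_map_eq EB; first exact: ra_stage_map.
  by rewrite EA; apply: ra_stage_map.
apply: ra_mor_eq => //.
have Eo : fob (Fc X) =1 fob (Fc X').
  case=> [i|i]; first exact: (fob_congr EA i).
  pose x := stbase (stages K n) (widen_ord (leq_pred K) i).
  have <- : muD (idm (catD n K) x) = inr i by rewrite /muD tgt_idm stmu_star.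
  by rewrite -!(ra_mu X) -(ra_mu X') EFd.
apply: functor_eq; apply: funext => // -[f|f].
  exact: (fmor_congr EA f).
by have := f_idm (Fc X) (inr f); have := f_idm (Fc X') (inr f) => /= -> ->; rewrite Eo.
Qed.

(** The action of [p_{i,j}] is preserved because it is, on both sides, the
    composite of the actions of the [p_{l,l+1}] with [i <= l < j]. *)
Theorem ra_obj_ext n K Y (A : functor (ordCat n.+1) (raC Y))
    (B : functor (ordCat K) (raD Y)) :
  (forall h, val (tgt (ordCat K) h) = K.-1 -> mu Y (B h) = fob A ord0) ->
  exists X : ra_mor (ra_obj n K) Y,
    compF (Fc X) (inlF _ _) = A /\ compF (Fd X) (base_functor K n) = B.
Proof.
move=> compat; pose p := step_arr A.
have p_chain j : src (raC Y) (p j.+1) = tgt (raC Y) (p j).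
  by rewrite step_src step_tgt.
have p0 h : val (tgt (ordCat K) h) = K.-1 -> mu Y (B h) = src (raC Y) (p 0).
  move=> /compat ->; rewrite step_src min0n; congr (fob A _).
  by apply: val_inj; rewrite /= inordK.
have [F [SF FB]] := stage_map_exists p_chain n p0.
pose wid (i : 'I_K.-1) : Ob (ordCat K) := widen_ord (leq_pred K) i.
pose s i := mu Y (B (idm (ordCat K) (wid i))).
have muF h : mu Y (F h) = fob (copair A s) (muD h).
  rewrite /muD; case Ej: (stmu _) => [j|i].
    have [mF _] := SF h j Ej; rewrite mF step_src /=; congr (fob A _).
    by rewrite (minn_idPl _) ?inord_val // -ltnS.
  rewrite /= /s -FB /=; apply: mu_tgt.
  rewrite !f_tgt base_ob (stmu_starP Ej); by [].
have actF d (i j : 'I_n.+1) (ij : i <= j) h (e : src (raC Y) (A (ord_arr ij)) = mu Y (F h)) :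
    val j = i + d -> muD h = inl i ->
    F (iter d (@ststep _ _ _) h) = act Y (A (ord_arr ij)) (F h) e.
  elim: d j ij e => [|d IH] j ij e Ej Ei.
    have Eij : i = j by apply: val_inj; rewrite /= Ej addn0.
    subst j; have e1 : src (raC Y) (idm (raC Y) (mu Y (F h))) = mu Y (F h).
      by rewrite src_idm.
    rewrite -[LHS](act_id e1); apply: act_congr => //.
    rewrite muF Ei /= -f_idm; congr (fmor A _); exact: ordMor_eq.
  (* [p_{i,j}] is split as [p_{m,j}] after [p_{i,m}], with [j = m + 1]. *)
  have lt_j : i + d < n.+1 by move: (ltn_ord j); rewrite [nat_of_ord j]Ej; lia.
  pose j' := Ordinal lt_j; have ij' : i <= j' by rewrite leq_addr.
  have j'j : j' <= j by rewrite [nat_of_ord j]Ej /= addnS.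
  have e2 : src (raC Y) (A (ord_arr ij')) = mu Y (F h) by rewrite -e !f_src.
  have mj' : stmu (tgt (catD n K) (iter d (@ststep _ _ _) h)) = inl j'.
    exact: muD_iter Ei _.
  have lt_jn : j' < n by move: (ltn_ord j); rewrite [nat_of_ord j]Ej /= addnS.
  have [e3 /= ->] := (SF _ _ mj').2 lt_jn.
  have Ep : p j' = A (ord_arr j'j).
    congr (fmor A _); apply: ordMor_eq; apply: val_inj => /=; rewrite inordK; 
      rewrite ?[nat_of_ord j]Ej; move: lt_jn => /=; lia.
  have ec : src (ordCat n.+1) (ord_arr j'j) = tgt (ordCat n.+1) (ord_arr ij') by [].
  have ec' : src (raC Y) (A (ord_arr j'j)) = tgt (raC Y) (A (ord_arr ij')).
    by rewrite f_src f_tgt ec.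
  have Eij : A (ord_arr ij) = comp (raC Y) (A (ord_arr j'j)) (A (ord_arr ij')) ec'.
    rewrite -(f_comp A ec); congr (fmor A _); exact: ordMor_eq.
  have e4 : src (raC Y) (comp (raC Y) (A (ord_arr j'j)) (A (ord_arr ij')) ec') = mu Y (F h).
    by rewrite -Eij.
  have e5 : src (raC Y) (A (ord_arr j'j)) = mu Y (act Y (A (ord_arr ij')) (F h) e2).
    by rewrite mu_act.
  rewrite (act_congr e e4) // (act_comp e4 e5).
  by apply: act_congr => //; apply: IH.
have ract f h (e : src (catC n K) f = muD h)
    (e' : src (raC Y) (copair A s f) = mu Y (F h)) :
    F (actD e) = act Y (copair A s f) (F h) e'.
  case: f e e' => [f|i] e e'.
    rewrite /actD; case: f e e' => -[i j] /= ij e e'.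
    apply: actF; last exact: esym e.
    by rewrite subnKC.
  have e1 : src (raC Y) (idm (raC Y) (mu Y (F h))) = mu Y (F h) by rewrite src_idm.
  rewrite -[LHS](act_id e1); apply: act_congr => //.
  by rewrite muF -e.
exists (@RAMor (ra_obj n K) Y (copair A s) F muF ract); split => //.
exact: functor_eq.
Qed.

(** * Maps between the objects, and injectivity of plus maps *)

(** An injective monotone [g] satisfies [i <= g i] by induction; applying this to
    [f] and to its conjugate under order reversal gives both inequalities. *)
Lemma mono_inj_id N (f : 'I_N -> 'I_N) :
  {homo f : i j / i <= j} -> injective f -> f =1 id.
Proof.
have below (g : 'I_N -> 'I_N) : {homo g : i j / i <= j} -> injective g ->
    forall i : 'I_N, i <= g i.
  move=> mono inj [k lt_k]; elim: k lt_k => [//|k IH] lt_k.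
  have lt_k' := ltnW lt_k; apply: leq_ltn_trans (IH lt_k') _.
  rewrite ltn_neqAle; apply/andP; split; last by apply: mono => /=.
  by apply/eqP => /val_inj/inj [] /n_Sn.
move=> mono inj i; apply/val_inj/anti_leq; apply/andP; split; last exact: below.
pose g j := rev_ord (f (rev_ord j)).
have := below g _ _ (rev_ord i); rewrite /g rev_ordK.
have [lt_i lt_fi] := (ltn_ord i, ltn_ord (f i)).
suff -> : (rev_ord i <= rev_ord (f i)) = (f i <= i).
  apply=> [j k jk|j k /rev_ord_inj/inj/rev_ord_inj//].
  have : f (rev_ord k) <= f (rev_ord j) by apply: mono => /=; lia.
  by move=> /=; lia.
by rewrite /=; apply/idP/idP; lia.
Qed.

Section Maps.
Variables (n K m L : nat).
Implicit Types X : ra_mor (ra_obj n K) (ra_obj m L).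

Lemma map_eq_on_generators X X' : (forall i, fob (Fc X) (inl i) = fob (Fc X') (inl i)) ->
  (forall i, fob (Fd X) (stbase (stages K n) i) = fob (Fd X') (stbase (stages K n) i)) ->
  X = X'.
Proof.
move=> EA EB; apply: ra_obj_uniq.
  by apply: (@thin_functor_eq _ (catC m L) _ _ (@catC_thin m L)) => i; apply: EA.
by apply: (@thin_functor_eq _ (catD m L) _ _ (@catD_thin m L)) => i /=; rewrite base_ob.
Qed.

(** The universal property for targets that are posets: only the objects of the
    two restrictions have to be given. *)
Lemma map_of_generators (a : 'I_n.+1 -> Ob (catC m L)) (b : 'I_K -> Ob (catD m L)) :
  (forall i j : 'I_n.+1, i <= j -> arrow (a i) (a j)) ->
  (forall i j : 'I_K, i <= j -> arrow (b i) (b j)) ->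
  (forall i, val i = K.-1 -> stmu (b i) = a ord0) ->
  exists X, (forall i, fob (Fc X) (inl i) = a i) /\
    (forall i, fob (Fd X) (stbase (stages K n) i) = b i).
Proof.
move=> /(functor_of_mono (@catC_thin m L))[A EA].
move=> /(functor_of_mono (@catD_thin m L))[B EB] compat.
have [h lh|X [XA XB]] := @ra_obj_ext n K (ra_obj m L) A B.
  by rewrite EA /= /muD f_tgt EB compat.
exists X; split=> i; first by rewrite -EA -XA.
by rewrite -EB -XB /= base_ob.
Qed.

Lemma stmu_Fd X (x : Ob (catD n K)) :
  stmu (fob (Fd X) x) = fob (Fc X) (stmu x).
Proof.
have := ra_mu X (idm (catD n K) x).
rewrite /= /muD tgt_idm => <-; congr stmu.
by rewrite [RHS]f_tgt tgt_idm.
Qed.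

Lemma alpha_arrow X (i j : 'I_n.+1) : i <= j ->
  arrow (fob (Fc X) (inl i)) (fob (Fc X) (inl j)).
Proof. by move=> ij; apply: arrow_fob; apply/arrow_catC. Qed.

Lemma beta_arrow X (i j : 'I_K) : i <= j ->
  arrow (fob (Fd X) (stbase (stages K n) i)) (fob (Fd X) (stbase (stages K n) j)).
Proof. by move=> ij; apply/arrow_fob/stbase_arrow. Qed.

(** The stars are isolated in [C_{m,l}] and [[n]] is connected. *)
Lemma alpha_star X i s : fob (Fc X) (inl i) = inr s ->
  forall j, fob (Fc X) (inl j) = inr s.
Proof.
have star0 j : fob (Fc X) (inl j) = inr s <-> fob (Fc X) (inl ord0) = inr s.
  have /arrow_catC := @alpha_arrow X ord0 j isT.
  by case: (fob _ _) => [a|a]; case: (fob _ _) => [b|b] // => ->.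
by move=> /star0 E j; apply/star0.
Qed.

Lemma alpha_inl X i c : fob (Fc X) (inl i) = inl c ->
  exists h : 'I_n.+1 -> 'I_m.+1, (forall j, fob (Fc X) (inl j) = inl (h j)) /\
   {homo h : i j / i <= j}.
Proof.
move=> Ei; pose h j := if fob (Fc X) (inl j) is inl c then c else ord0.
have Eh j : fob (Fc X) (inl j) = inl (h j).
  rewrite /h; case Ej: (fob _ _) => [//|s].
  by have := alpha_star Ej i; rewrite Ei.
exists h; split=> // j k /(alpha_arrow X); rewrite !Eh.
by move=> /arrow_catC.
Qed.
End Maps.

(** Every object receives an arrow from [[k]], so [[k]] is inhabited when
    [D_{n,k}] is. *)
Lemma base_inhab n K (x : Ob (catD n K)) : 0 < K.
Proof.
elim: n x => [|n IH]; first by move=> /= x; apply: leq_ltn_trans (ltn_ord x).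
by case=> [x|i]; [apply: IH | apply: IH (adjIdx_src i)].
Qed.

Section StageInj.
Variables (m L K : nat) (p : nat -> Mor (catC m L)) (a : nat -> 'I_m.+1).

Lemma stage_map_mu n (F : functor (catD n K) (catD m L)) x (j : 'I_n.+1) :
  @stage_map K (ra_obj m L) p n F -> stmu x = inl j ->
  stmu (fob F x) = src (catC m L) (p j).
Proof.
move=> SF Ej; have [|/esym E _] := SF (idm (catD n K) x) j; first by rewrite tgt_idm.
by rewrite [RHS]E /= /muD f_tgt tgt_idm.
Qed.

(** Two new objects with the same image have the same label by [actD_tgt_inj].
    A new object and an old one have images of different moments, unless perhaps
    the old one is some [i] of [[k]]; but then its image precedes that of the last
    element of [[k]], of moment [a 0], so by [arrow_stmu] it cannot have the larger
    moment [a n.+1] of the image of a new object. *)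
Lemma stage_map_inj n (F : functor (catD n K) (catD m L)) :
  @stage_map K (ra_obj m L) p n F ->
  (forall j, j < n -> src (catC m L) (p j) = inl (a j) /\
                      tgt (catC m L) (p j) = inl (a j.+1)) ->
  (forall i j, i < j -> j <= n -> a i < a j) ->
  injective (fun i => fob F (stbase (stages K n) i)) -> injective (fob F).
Proof.
elim: n F => [//|n IH] F SF pE mono inj.
have inj0 : injective (fob (compF F (stage_incl K n))).
  apply: (IH (compF F (stage_incl K n))) => //.
  - exact: (@stage_map_incl K (ra_obj m L)).
  - by move=> j jn; apply: pE; apply: ltnW.
  - by move=> i j ij jn; apply: mono => //; apply: ltnW.
(* The target of the generating arrow [p_{n,n+1} . h] is sent to that of
   [p n . F h]. *)
have new (i : adjIdx (stages K n)) :
    exists e : src (catC m L) (p n) = muD (F (stage_incl K n (val i))),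
    fob F (inr i) = tgt (catD m L) (actD e).
  have Ei : stmu (tgt (catD n.+1 K) (stage_incl K n (val i))) =
      inl (widen_ord (leqnSn n.+1) ord_max).
    by rewrite /= (eqP (valP i)).
  have [_ [|e E]] := SF _ _ Ei; first exact: ltnSn.
  by exists e; rewrite -[actD e]E ststep_gen f_tgt.
have [sn tn] := pE n (ltnSn n).
have Npn : src (catC m L) (p n) <> tgt (catC m L) (p n).
  by rewrite sn tn => -[E]; have := mono n n.+1; rewrite E ltnn => /(_ _ _)/notF; apply.
have new_mu i : stmu (fob F (inr i)) = inl (a n.+1).
  have [e ->] := new i; rewrite -tn; exact: (@mu_act _ _ (ra_obj m L) _ _ e).
have old_new (x : Ob (catD n K)) i : fob F (inl x) <> fob F (inr i).
  have Fx (y : Ob (catD n K)) j : stmu y = inl j -> stmu (fob F (inl y)) = inl (a j).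
    move=> Ej; have [<- _] := pE j (ltn_ord j).
    rewrite (@stage_map_mu _ F (inl y) (widen_ord (leqnSn n.+1) j)) //.
    by rewrite /= Ej.
  have lt_j (j : 'I_n.+1) : a j < a n.+1 by apply: mono.
  have based (j : 'I_K) : x = stbase (stages K n) j -> stmu (fob F (inl x)) <> inl (a n.+1).
    have lK : K.-1 < K by rewrite prednK // (base_inhab x).
    pose l := Ordinal lK; have jl : j <= l by have := ltn_ord j; rewrite /=; lia.
    move=> Ex; have xl : arrow (fob F (inl x)) (fob F (inl (stbase (stages K n) l))).
      by apply: arrow_fob; apply/adjoin_arrow; rewrite Ex; apply: stbase_arrow.
    have Fl := Fx _ _ (@stmu_last n K l erefl).
    have lt0 := lt_j ord0; move=> Fxa; case: (arrow_stmu xl Fxa) => [E|[d]].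
      by move: Fl; rewrite -E Fxa => -[E0]; rewrite E0 ltnn in lt0.
    by rewrite Fl => -[<-] /(ltn_trans lt0); rewrite ltnn.
  move=> E; have := new_mu i; rewrite -E.
  case: (stmu_cases x) => [[j Ex _]|[j Ex _]|[j Ej _]]; try exact: based Ex.
  by rewrite (Fx _ _ Ej) => -[Ea]; have := lt_j j; rewrite Ea ltnn.
move=> [x|i] [y|j] E.
- by congr inl; apply: inj0.
- by case: (old_new x j E).
- by case: (old_new y i (esym E)).
have [ei Ei] := new i; have [ej Ej] := new j.
congr inr; apply: val_inj; apply: catD_thin.
all: have Eh : F (stage_incl K n (val i)) = F (stage_incl K n (val j)) by
  apply: (actD_tgt_inj Npn (e := ei) (e' := ej)); rewrite -Ei -Ej.
- have := f_equal (src (catD m L)) Eh; rewrite !f_src => /inj0; exact.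
- have := f_equal (tgt (catD m L)) Eh; rewrite !f_tgt => /inj0; exact.
Qed.
End StageInj.

Section Plus.
Variables (n K m L : nat) (X : ra_mor (ra_obj n K) (ra_obj m L)).
Hypothesis alpha_inj : injective (fun i => fob (Fc X) (inl i)).
Hypothesis beta_inj : injective (fun i => fob (Fd X) (stbase (stages K n) i)).

Lemma plus_alpha : 0 < n -> exists h : 'I_n.+1 -> 'I_m.+1,
  [/\ forall j, fob (Fc X) (inl j) = inl (h j), injective h & 
     {homo h : i j / i <= j}].
Proof.
move=> n0; case E0 : (fob (Fc X) (inl ord0)) => [c|s]; last first.
  have := alpha_star E0 ord_max; rewrite -E0 => /alpha_inj[En].
  by rewrite En in n0.
have [h [Eh mono]] := alpha_inl E0; exists h; split=> // i j Eij.
by apply: alpha_inj; rewrite !Eh Eij.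
Qed.

(** For [n = 0] the image of 0 may be a star; the whole of [D_{0,k}] is then [[k]],
    and nothing has to be said about the images of the [p_{j,j+1}]. *)
Lemma Fd_inj : injective (fob (Fd X)).
Proof.
have SX := ra_stage_map X.
pose p := step_arr (compF (Fc X) (inlF (ordCat n.+1) (discCat 'I_K.-1))).
have [n0|n_gt0] := posnP n.
  apply: (@stage_map_inj m L K p (fun=> ord0)) => //.
    by move=> j; rewrite n0.
  by move=> i j ij jn; move: (leq_trans ij jn); rewrite n0.
have [h [Eh h_inj h_mono]] := plus_alpha n_gt0.
apply: (@stage_map_inj m L K p (fun j => h (inord (minn j n)))) => //.
  move=> j _; split.
    by apply: etrans (step_src _ j) _; apply: Eh.
  by apply: etrans (step_tgt _ j) _; apply: Eh.
move=> i j ij jn; rewrite ltn_neqAle.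
have [-> ->] : minn i n = i /\ minn j n = j by lia.
apply/andP; split; last by apply: h_mono; rewrite !inordK; lia.
apply/eqP => /val_inj/h_inj/(f_equal val); rewrite /= !inordK; lia.
Qed.

(** The images of the stars are the moments of the images of the elements of [[k]]
    other than the last.  Along this injective chain moments that lie in [[m]] grow
    strictly, up to the image of 0 in [[n]], and equal moments force equal
    objects. *)
Lemma Fc_inj : injective (fob (Fc X)).
Proof.
have star (s : 'I_K.-1) : fob (Fc X) (inr s) =
    stmu (fob (Fd X) (stbase (stages K n) (widen_ord (leq_pred K) s))).
  by rewrite stmu_Fd stmu_star.
have starlt (s t : 'I_K.-1) : s <= t -> fob (Fc X) (inr s) = fob (Fc X) (inr t) -> s = t.
  move=> st; rewrite !star => E; apply: val_inj.
  have wst : widen_ord (leq_pred K) s <= widen_ord (leq_pred K) t by [].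
  by have /beta_inj/(f_equal val) := arrow_stmu_eq (beta_arrow X wst) E.
have ord_star (j : 'I_n.+1) (s : 'I_K.-1) : fob (Fc X) (inl j) <> fob (Fc X) (inr s).
  have lK : K.-1 < K by rewrite prednK //; have := ltn_ord s; lia.
  pose l := Ordinal lK; pose w := widen_ord (leq_pred K) s.
  have sl : w <= l by rewrite /= ltnW.
  have Nsl : w <> l by move=> /(f_equal val) /= E; have := ltn_ord s; rewrite E ltnn.
  have wl := beta_arrow X sl.
  have El : fob (Fc X) (inl ord0) = stmu (fob (Fd X) (stbase (stages K n) l)).
    by rewrite stmu_Fd stmu_last.
  have a0j := @alpha_arrow _ _ _ _ X ord0 j isT.
  rewrite star -/w => Ew.
  case Ej: (fob (Fc X) (inl j)) Ew => [c|t] Ew; last first.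
    apply/Nsl/beta_inj/(arrow_stmu_eq wl).
    by rewrite -El -Ew (alpha_star Ej).
  case: (arrow_stmu wl (esym Ew)) => [/beta_inj//|[d]].
  rewrite -El => E0 lt; move: a0j; rewrite Ej E0 => /arrow_catC /=.
  by rewrite leqNgt lt.
move=> [i|s] [j|t] E.
- by congr inl; apply: alpha_inj.
- by case: (ord_star i t E).
- by case: (ord_star j s (esym E)).
- by congr inr; case: (leqP s t) => [|/ltnW] st; [|symmetry]; apply: starlt.
Qed.

Lemma plus_leq_n : n <= m.
Proof.
case: (posnP n) => [->//|/plus_alpha[h [_ /leq_card]]].
by rewrite !card_ord.
Qed.

Lemma plus_leq_card : #|stO (stages K n)| <= #|stO (stages L m)|.
Proof. exact: leq_card Fd_inj. Qed.
End Plus.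

(** * Minus maps split, degrees, and factorizations *)

Section Minus.
Variables (n K m L : nat) (X : ra_mor (ra_obj n K) (ra_obj m L)).
Hypothesis alpha_surj : forall j : 'I_m.+1, exists i, fob (Fc X) (inl i) = inl j.
Hypothesis Fd_surj : forall y, exists x, fob (Fd X) x = y.

(** The moment of the image of the last element of [[k]] is 0, so it is the last
    element of [[l]], and its predecessors land in [[l]].  Conversely an object over
    an element of [[l]] is in [[k]] unless its moment is positive and sent to 0; the
    element is then the last one, which is the image of the last element of
    [[k]]. *)
Lemma minus_restrictions : exists (h : 'I_n.+1 -> 'I_m.+1) (g : 'I_K -> 'I_L),
  [/\ forall i, fob (Fc X) (inl i) = inl (h i),
      forall i, fob (Fd X) (stbase (stages K n) i) = stbase (stages L m) (g i),
      (forall j, exists i, h i = j) /\ {homo h : i j / i <= j} &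
      (forall j, exists i, g i = j) /\ {homo g : i j / i <= j}].
Proof.
have [i0 Ei0] := alpha_surj ord0; have [h [Eh h_mono]] := alpha_inl Ei0.
have h_surj j : exists i, h i = j.
  by have [i] := alpha_surj j; rewrite Eh => -[]; exists i.
have h0 : h ord0 = ord0 by apply: first_surj.
have last_last (k : 'I_K) : val k = K.-1 -> exists2 l : 'I_L,
    fob (Fd X) (stbase (stages K n) k) = stbase (stages L m) l & val l = L.-1.
  by move=> lk; apply: stmu_zeroP; rewrite stmu_Fd stmu_last // Eh h0.
have based i : exists j, fob (Fd X) (stbase (stages K n) i) = stbase (stages L m) j.
  have lK : K.-1 < K by have := ltn_ord i; lia.
  have [l El _] := last_last (Ordinal lK) erefl.
  have il : i <= Ordinal lK by have := ltn_ord i; rewrite /=; lia.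
  by have := beta_arrow X il; rewrite El => /arrow_base[j ->]; exists j.
pose g i := projT1 (cid (based i)).
have Eg i : fob (Fd X) (stbase (stages K n) i) = stbase (stages L m) (g i).
  by rewrite /g; case: cid.
exists h, g; split=> //; split.
  move=> j; have [x Ex] := Fd_surj (stbase (stages L m) j).
  case: (stmu_cases x) => [[i Ei _]|[i Ei _]|[c Ec _]].
  - by exists (widen_ord (leq_pred K) i); apply: (@stbase_inj m L); rewrite -Eg -Ei.
  - by exists i; apply: (@stbase_inj m L); rewrite -Eg -Ei.
  have lK : K.-1 < K by rewrite prednK // (base_inhab x).
  exists (Ordinal lK); apply: (@stbase_inj m L); rewrite -Eg.
  have [l -> ll] := last_last (Ordinal lK) erefl; congr stbase.
  apply: val_inj; rewrite [LHS]ll /=.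
  have := stmu_Fd X x; rewrite Ex Ec Eh stmu_base; case: insubP => //= lj _.
  by have := ltn_ord j; lia.
move=> i j /(beta_arrow X); rewrite !Eg => /arrow_base[k /stbase_inj ->]; exact.
Qed.
End Minus.

(** The sections of [h] and [g] are chosen to send 0 to 0 and the last element of
    [[l]] to that of [[k]], because a map out of [[m o l]] sends the last element of
    [[l]] to an object whose moment is the image of 0. *)
Lemma degeneracy_section n K m L (X : ra_mor (ra_obj n K) (ra_obj m L))
    (h : 'I_n.+1 -> 'I_m.+1) (g : 'I_K -> 'I_L) :
  (forall i, fob (Fc X) (inl i) = inl (h i)) ->
  (forall i, fob (Fd X) (stbase (stages K n) i) = stbase (stages L m) (g i)) ->
  (forall j, exists i, h i = j) -> {homo h : i j / i <= j} ->
  (forall j, exists i, g i = j) -> {homo g : i j / i <= j} ->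
  exists S, ra_comp X S = ra_id (ra_obj m L).
Proof.
move=> Eh Eg h_surj h_mono g_surj g_mono.
have [s [sK s_mono s0]] := mono_section (Some ord0) h_surj h_mono.
have [t [tK t_mono tl]] := mono_section (insub K.-1) g_surj g_mono.
have h0 : h ord0 = ord0 by apply: first_surj.
have [||l ll|S [SA SB]] := @map_of_generators m L n K (fun j => inl (s j))
    (fun j => stbase (stages K n) (t j)).
- by move=> i j /s_mono ij; apply/arrow_catC.
- by move=> i j /t_mono; apply: stbase_arrow.
- have [i _] := g_surj l.
  have lK : K.-1 < K by have := ltn_ord i; lia.
  have -> : l = g (Ordinal lK) by apply: val_inj; rewrite [LHS]ll (@last_surj K).
  by rewrite tl ?stmu_last // -?h0 ?s0 // insubT.
exists S; apply: map_eq_on_generators => i /=; first by rewrite SA Eh sK.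
by rewrite SB Eg tK.
Qed.

(** If 0 were sent to a star then [n = 0]; a preimage of the last element of [[l]]
    would be the last element of [[k]], whose image has that star as its moment
    instead of 0.  So [alpha] is the identity of [[n]]; in particular the map is a
    minus map, and [beta] is a monotone bijection [[k] -> [l]]. *)
Lemma plus_bijective_identity n K L (X : ra_mor (ra_obj n K) (ra_obj n L)) :
  injective (fun i => fob (Fc X) (inl i)) ->
  injective (fun i => fob (Fd X) (stbase (stages K n) i)) ->
  (forall y, exists x, fob (Fd X) x = y) ->
  is_identity (@FullMor _ (fun x => ra_obj x.1 x.2) (n, K) (n, L) X : Mor DeltaDelta).
Proof.
move=> A_inj B_inj Fd_surj.
have [h [Eh h_inj h_mono]] : exists h : 'I_n.+1 -> 'I_n.+1,
  [/\ forall j, fob (Fc X) (inl j) = inl (h j), injective h & 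
     {homo h : i j / i <= j}].
  have [n0|/(plus_alpha A_inj)//] := posnP n.
  case E0 : (fob (Fc X) (inl ord0)) => [c|s].
    have [h [Eh h_mono]] := alpha_inl E0; exists h; split=> // i j Eij.
    by apply: A_inj; rewrite /= !Eh Eij.
  exfalso; have lL : L.-1 < L by have := ltn_ord s; lia.
  pose y := stbase (stages L n) (Ordinal lL).
  have Ey : stmu y = inl ord0 by apply: stmu_last.
  have [x Ex] := Fd_surj y.
  have lK : K.-1 < K by rewrite prednK // (base_inhab x).
  have based (j : 'I_K) : x = stbase (stages K n) j -> False.
    move=> Ej; have jl : j <= Ordinal lK by have := ltn_ord j; rewrite /=; lia.
    have := beta_arrow X jl; rewrite -Ej Ex => yl.
    have El : stmu (fob (Fd X) (stbase (stages K n) (Ordinal lK))) = inr s.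
      by rewrite stmu_Fd stmu_last.
    case: (arrow_stmu yl Ey) => [E|[d]]; last by rewrite El.
    by move: El; rewrite -E Ey.
  case: (stmu_cases x) => [[j /based]|[j /based]|[j _]] //.
  have j_le0 : j <= 0 by rewrite -n0 -ltnS ltn_ord.
  by rewrite ltnNge j_le0.
have h_id := mono_inj_id h_mono h_inj.
have [|h' [g [_ Eg _ [g_surj g_mono]]]] := @minus_restrictions _ _ _ _ X _ Fd_surj.
  by move=> j; exists j; rewrite Eh h_id.
have g_inj : injective g.
  by move=> i j Eij; apply: B_inj; rewrite /= !Eg Eij.
have EKL : K = L.
  have [s sK] : exists s, cancel s g.
    by exists (fun j => projT1 (cid (g_surj j))) => j; case: cid.
  have := leq_card _ (can_inj sK); have := leq_card _ g_inj.
  by rewrite !card_ord => KL LK; apply/anti_leq; rewrite KL.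
subst L; have g_id := mono_inj_id g_mono g_inj.
exists (n, K); congr FullMor; apply: map_eq_on_generators => i /=; first by rewrite Eh h_id.
by rewrite Eg g_id.
Qed.

Lemma plus_raises n K m L (X : ra_mor (ra_obj n K) (ra_obj m L)) :
  injective (fun i => fob (Fc X) (inl i)) ->
  injective (fun i => fob (Fd X) (stbase (stages K n) i)) ->
  ~ is_identity (@FullMor _ (fun x => ra_obj x.1 x.2) (n, K) (m, L) X : Mor DeltaDelta) ->
  n + #|stO (stages K n)| < m + #|stO (stages L m)|.
Proof.
move=> A_inj B_inj; have le_nm := plus_leq_n A_inj.
have le_card := plus_leq_card A_inj B_inj.
case: (ltnP (n + _)) => // ge []; have Enm : n = m by lia.
subst m; apply: plus_bijective_identity => // y.
have /codomP[x ->] : y \in codom (fob (Fd X)).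
  by apply: (inj_card_onto (Fd_inj A_inj B_inj)); lia.
by exists x.
Qed.

(** Both restrictions are factored through their images.  The first element of [[r]]
    and the last one of the image of [beta] come from 0 and from the last element
    of [[k]], so compatibility is inherited.  The first factor splits, hence is a
    minus map. *)
Lemma plus_minus_factorization n K m L (X : ra_mor (ra_obj n K) (ra_obj m L)) :
  exists r S (P : ra_mor (ra_obj n K) (ra_obj r S)) (Q : ra_mor (ra_obj r S) (ra_obj m L)),
   [/\ ra_comp Q P = X, exists T, ra_comp P T = ra_id (ra_obj r S),
       forall j : 'I_r.+1, exists i, fob (Fc P) (inl i) = inl j,
       injective (fun i => fob (Fc Q) (inl i)) &
       injective (fun i => fob (Fd Q) (stbase (stages S r) i))].
Proof.
have [r [h [a [Ea a_inj h_surj h_mono a_mono]]]] :=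
  mono_image (@catC_antisym m L) (@alpha_arrow _ _ _ _ X).
have [S [g [b [Eb b_inj g_surj g_mono b_mono]]]] :=
  mono_image (@catD_antisym m L) (@beta_arrow _ _ _ _ X).
(* The image of [[n]] is not empty. *)
case: r => [|r] in h a Ea a_inj h_surj h_mono a_mono *.
  by case: (h ord0) => ? /=; rewrite ltn0.
have h0 := first_surj h_surj h_mono.
have [||i li|P [PA PB]] := @map_of_generators n K r S (fun j => inl (h j))
    (fun j => stbase (stages S r) (g j)).
- by move=> i j /h_mono ij; apply/arrow_catC.
- by move=> i j /g_mono; apply: stbase_arrow.
- by rewrite stmu_last ?h0 // (@last_surj K).
have [l ll|Q [QA QB]] := map_of_generators a_mono b_mono.
  have [i _] := g_surj l.
  have lK : K.-1 < K by have := ltn_ord i; lia.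
  have -> : l = g (Ordinal lK) by apply: val_inj; rewrite [LHS]ll (@last_surj K).
  have := Eb (Ordinal lK); rewrite /= => <-.
  by rewrite stmu_Fd stmu_last // -h0; apply: Ea.
exists r, S, P, Q; split.
- apply: map_eq_on_generators => i /=; first by rewrite PA QA; apply/esym/Ea.
  by rewrite PB QB; apply/esym/Eb.
- exact: degeneracy_section PA PB h_surj h_mono g_surj g_mono.
- by move=> j; have [i <-] := h_surj j; exists i.
- by move=> i j; rewrite !QA => /a_inj.
- by move=> i j; rewrite !QB => /b_inj.
Qed.

(** Equal morphisms of the full subcategory are equal as maps of rooted actions once
    transported along any identification of their ends. *)
Lemma full_mor_eq I (X : I -> rooted_action) (u v : full_mor X) (e : u = v)
    (e1 : fm_dom v = fm_dom u) (e2 : fm_cod v = fm_cod u) :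
  ecast i (ra_mor (X i) _) e1 (ecast j (ra_mor _ (X j)) e2 (fm_map v)) = fm_map u.
Proof.
by subst v; rewrite (Prop_irrelevance e1 erefl) (Prop_irrelevance e2 erefl).
Qed.

Lemma full_mor_inj I (X : I -> rooted_action) i j (F G : ra_mor (X i) (X j)) :
  FullMor F = FullMor G -> F = G.
Proof. by move=> E; have /= := full_mor_eq E erefl erefl. Qed.

Theorem theorem2p14 :
  is_reedy (R := DeltaDelta) DeltaDelta_plus DeltaDelta_minus DeltaDelta_deg.
Proof.
apply: reedy_of_split_epi.
- split; first by move=> x; split=> i j; [case | apply: stbase_inj].
  move=> [j k g] [i j' f] /= e; subst j'.
  move=> [ga gb] [fa fb]; split=> u v.
    by move=> /(Fc_inj ga gb)/fa.
  by move=> /(Fd_inj ga gb)/fb.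
- split.
    by move=> x; split=> y; [exists y | exists y].
  move=> [j k g] [i j' f] /= e; subst j'.
  move=> [ga gb] [fa fb]; split=> y.
    have [u Eu] := ga y; have [v Ev] := fa u; exists v.
    by rewrite /alpha /= in Ev *; rewrite Ev.
  by have [u <-] := gb y; have [v <-] := fb u; exists v.
- move=> [j k g] [i j' f] /= e; subst j'.
  move=> [ga gb]; split=> u v E.
    by apply: ga; apply: (f_equal (fob (Fc g))).
  by apply: gb; apply: (f_equal (fob (Fd g))).
- move=> [j k q] [i j' f] [i' j'' g] /= e e' [qa qb]; subst j' j'' => /= E.
  have Ei : i = i' := f_equal (@fm_dom _ _) E.
  subst i'; have {}E := full_mor_inj E; congr FullMor; apply: map_eq_on_generators => u.
    apply: (Fc_inj qa qb); exact: (fob_congr (f_equal (@Fc _ _) E)).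
  apply: (Fd_inj qa qb); exact: (fob_congr (f_equal (@Fd _ _) E)).
- by move=> [[n K] [m L] f] [fa fb]; apply: plus_raises.
- move=> [[n K] [m L] f] [fa fb].
  have [h [g [Eh Eg [h_surj h_mono] [g_surj g_mono]]]] := minus_restrictions fa fb.
  have [S ES] := degeneracy_section Eh Eg h_surj h_mono g_surj g_mono.
  exists (@FullMor _ _ (m, L) (n, K) S), erefl.
  by congr FullMor.
- move=> [[n K] [m L] f].
  have [r [S [P [Q [E [T ET] Pa Qa Qb]]]]] := plus_minus_factorization f.
  exists (@FullMor _ _ (n, K) (r, S) P), (@FullMor _ _ (r, S) (m, L) Q).
  split=> //; last by exists erefl; rewrite /= /full_comp /= E.
  split=> // y; exists (fob (Fd T) y).
  exact: (fob_congr (f_equal (@Fd _ _) ET) y).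
Qed.
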